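(* Assume that condition (ND) holds, that $k\ge1$ is an integer, and that either $k=1$ or condition (L) holds. Then there is $c\in[0,1]$ such that: (i) $\displaystyle\limsup_{h\to0}\frac{|f_k(x+h)-f_k(x)|}{|h|^c}=+\infty$ for $\mu_0$-a.s. $x$. (ii) For every nonempty open interval $J\subset[0,1]$, $$\sup_{x,y\in J,\,x>y}\frac{f_k(x)-f_k(y)}{(x-y)^c}=+\infty\quad\text{and}\quad\inf_{x,y\in J,\,x>y}\frac{f_k(x)-f_k(y)}{(x-y)^c}=-\infty .$$ Moreover, $c$ can be taken with $c<1$ if $\mu_0$ is singular, and $c=1$ if $\mu_0$ is absolutely continuous; and if (L) holds, $c$ does not depend on $k$.
   Context: Setting. Let $E\subset\mathbb{R}^3$ be the set of $(b,u,v)$ with $0<b<1$, $b-1<u<\frac1b-1$, $-b<v<\frac{b}{1-b}$, and such that $(1+v)(1-b(1+u))^2<1-b$ or $(b+v)^2<b(1+u)(1+v)^2$. Fix an open interval $I\ni 0$ and a smooth ($C^\infty$) curve $t\mapsto(b_1(t),c_0(t),c_1(t))\in E$, $t\in I$; write $b_1,c_0,c_1$ for the values at $t=0$. For $A=\begin{pmatrix}a&b\\c&d\end{pmatrix}$ put $\Phi(A;z)=\frac{az+b}{cz+d}$, and let $$A_0(t)=\begin{pmatrix}b_1(t)(1+c_0(t))&0\\c_0(t)&1\end{pmatrix},\quad A_1(t)=\begin{pmatrix}1-b_1(t)+c_1(t)&b_1(t)\\c_1(t)&1\end{pmatrix}.$$ For $t\in I$, $F(t,\cdot)$ is the unique continuous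 $f:[0,1]\to[0,1]$ with $f(x)=\Phi(A_0(t);f(2x))$ for $0\le x\le\frac12$ and $f(x)=\Phi(A_1(t);f(2x-1))$ for $\frac12\le x\le1$; it is strictly increasing with $F(t,0)=0$, $F(t,1)=1$, and $\mu_t$ is the probability measure on $[0,1]$ with distribution function $F(t,\cdot)$. It is known that $\mu_0$ is absolutely continuous (w.r.t. Lebesgue measure) if $c_0=\frac1{2b_1}-1$ and $c_1=1-2b_1$, and singular otherwise. Define $f_k(x)=\partial_t^kF(0,x)$ (these exist and are continuous in $x$). Condition (L): $(b_1(t),c_0(t),c_1(t))=(t+a,0,0)$ for some $a\in(0,1)$. Condition (ND). Put $G_0(t,y)=b_1(t)(1+c_0(t))y+c_0(t)$, $G_1(t,y)=\frac{(1-b_1(t)+c_1(t))y+c_1(t)}{b_1(t)y+1}$, $\alpha=\min\{0,\frac{c_0}{1-b_1(1+c_0)},\frac{c_1}{b_1}\}$, $\beta=\max\{0,\frac{c_0}{1-b_1(1+c_0)},\frac{c_1}{b_1}\}$. The dual curve is $(\widetilde b_1,\widetilde c_0,\widetilde c_1)(t)=\left(1-b_1(t),-\frac{c_1(t)}{1+c_1(t)},-\frac{c_0(t)}{1+c_0(t)}\right)$, and $\widetilde G_i,\widetilde\alpha,\widetilde\beta$ are defined from it by the same formulas. Let $\delta_i=\min_{y\in[\alpha,\beta]}\frac{\partial_tG_i(0,y)}{1-\partial_yG_i(0,y)}$, $\widetilde\delta_i=\max_{y\in[\widetilde\alpha,\widetilde\beta]}\frac{\partial_t\widetilde G_i(0,y)}{1-\partial_y\widetilde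 G_i(0,y)}$, $i=0,1$ ($\delta_1$ is considered defined only if $\partial_yG_1(0,\cdot)<1$ on $[\alpha,\beta]$, $\widetilde\delta_1$ only if $\partial_y\widetilde G_1(0,\cdot)<1$ on $[\widetilde\alpha,\widetilde\beta]$; at least one is defined). (ND) means: either $\delta_1$ is defined and $b_1'(0)(\alpha+1)+b_1(1-b_1)\min\{0,\delta_0,\delta_1\}>0$, or $\widetilde\delta_1$ is defined and $\widetilde b_1'(0)(\widetilde\alpha+1)+\widetilde b_1(0)(1-\widetilde b_1(0))\max\{0,\widetilde\delta_0,\widetilde\delta_1\}<0$. *)

(* Defs.v *)
From mathcomp Require Import all_boot all_order all_algebra.
From mathcomp Require Import all_classical all_reals all_analysis.

Set Implicit Arguments.
Unset Strict Implicit.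
Unset Printing Implicit Defensive.

Import Order.TTheory GRing.Theory Num.Theory.
Import numFieldNormedType.Exports.

Local Open Scope classical_set_scope.
Local Open Scope ring_scope.

Definition paramE (R : realType) (b u v : R) : Prop :=
  [/\ 0 < b < 1,
      b - 1 < u < b^-1 - 1,
      - b < v < b / (1 - b) &
      (1 + v) * (1 - b * (1 + u)) ^+ 2 < 1 - b \/
      (b + v) ^+ 2 < b * (1 + u) * (1 + v) ^+ 2].

Definition open_interval (R : realType) (I : set R) : Prop :=
  open I /\ is_interval I.

(* [I] is meant to be open, so that the iterated derivatives on [I] do not
   depend on the values of [g] outside [I]. *)
Definition smooth_on (R : realType) (I : set R) (g : R -> R) : Prop :=
  forall n t, I t -> derivable (derive1n n g) t 1.

(* A curve (b_1, c_0, c_1) is given by its three coordinate functions, of which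
   only the values on [I] matter. *)
Definition smooth_curve_in_E (R : realType) (I : set R) (b1 c0 c1 : R -> R) :
    Prop :=
  [/\ smooth_on I b1, smooth_on I c0, smooth_on I c1 &
      forall t, I t -> paramE (b1 t) (c0 t) (c1 t)].

Definition mx22 (R : realType) (a b c d : R) : 'M[R]_2 :=
  \matrix_(i < 2, j < 2)
    if i == 0 then (if j == 0 then a else b) else (if j == 0 then c else d).

Definition Phi (R : realType) (A : 'M[R]_2) (z : R) : R :=
  (A 0 0 * z + A 0 1) / (A 1 0 * z + A 1 1).

Definition A0 (R : realType) (b1 c0 : R -> R) (t : R) : 'M[R]_2 :=
  mx22 (b1 t * (1 + c0 t)) 0 (c0 t) 1.

Definition A1 (R : realType) (b1 c1 : R -> R) (t : R) : 'M[R]_2 :=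
  mx22 (1 - b1 t + c1 t) (b1 t) (c1 t) 1.

(* The restriction of [f] to [0, 1] is a continuous self-map of [0, 1] solving
   de Rham's functional equation for the matrices [M0] and [M1]; the values of
   [f] outside [0, 1] are irrelevant. *)
Definition deRham_solution (R : realType) (M0 M1 : 'M[R]_2) (f : R -> R) :
    Prop :=
  [/\ {within `[0, 1], continuous f},
      forall x, 0 <= x <= 1 -> 0 <= f x <= 1,
      forall x, 0 <= x <= 2^-1 -> f x = Phi M0 (f (2 * x)) &
      forall x, 2^-1 <= x <= 1 -> f x = Phi M1 (f (2 * x - 1))].

Definition distribution_function01 (R : realType)
    (mu : probability (measurableTypeR R) R) (f : R -> R) : Prop :=
  mu `[0, 1]%classic = 1%E /\ forall x, 0 <= x <= 1 -> mu `[0, x]%classic = (f x)%:E.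

Definition mutually_singular (d : measure_display) (T : measurableType d)
    (R : realType) (mu nu : set T -> \bar R) : Prop :=
  exists N : set T, [/\ measurable N, mu (~` N) = 0%E & nu N = 0%E].

Definition fder (R : realType) (F : R -> R -> R) (k : nat) (x : R) : R :=
  derive1n k (fun t => F t x) 0.

Definition condL (R : realType) (I : set R) (b1 c0 c1 : R -> R) : Prop :=
  exists a : R, 0 < a < 1 /\
    forall t, I t -> [/\ b1 t = t + a, c0 t = 0 & c1 t = 0].

Definition G0 (R : realType) (b1 c0 : R -> R) (t y : R) : R :=
  b1 t * (1 + c0 t) * y + c0 t.

Definition G1 (R : realType) (b1 c1 : R -> R) (t y : R) : R :=
  ((1 - b1 t + c1 t) * y + c1 t) / (b1 t * y + 1).

Definition alpha (R : realType) (b u v : R) : R :=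
  Num.min 0 (Num.min (u / (1 - b * (1 + u))) (v / b)).

Definition beta (R : realType) (b u v : R) : R :=
  Num.max 0 (Num.max (u / (1 - b * (1 + u))) (v / b)).

Definition is_minimum (R : realType) (S : set R) (m : R) : Prop :=
  S m /\ lbound S m.

Definition is_maximum (R : realType) (S : set R) (m : R) : Prop :=
  S m /\ ubound S m.

Definition dG_dt0 (R : realType) (G : R -> R -> R) (y : R) : R :=
  derive1 (fun t => G t y) 0.

Definition dG_dy0 (R : realType) (G : R -> R -> R) (y : R) : R :=
  derive1 (fun z => G 0 z) y.

Definition delta_ratio (R : realType) (G : R -> R -> R) (y : R) : R :=
  dG_dt0 G y / (1 - dG_dy0 G y).

(* The first conjunct says that delta_1 is defined; delta_0 always is, since
   d_y G_0(0, .) = b_1 (1 + c_0) < 1. *)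
Definition ND_primal (R : realType) (b1 c0 c1 : R -> R) : Prop :=
  let al := alpha (b1 0) (c0 0) (c1 0) in
  let be := beta (b1 0) (c0 0) (c1 0) in
  (forall y, al <= y <= be -> dG_dy0 (G1 b1 c1) y < 1) /\
  exists delta0 delta1 : R,
    [/\ is_minimum (delta_ratio (G0 b1 c0) @` `[al, be]) delta0,
        is_minimum (delta_ratio (G1 b1 c1) @` `[al, be]) delta1 &
        0 < derive1 b1 0 * (al + 1)
            + b1 0 * (1 - b1 0) * Num.min 0 (Num.min delta0 delta1)].

Definition dual_b1 (R : realType) (b1 : R -> R) (t : R) : R := 1 - b1 t.
Definition dual_c0 (R : realType) (c1 : R -> R) (t : R) : R :=
  - (c1 t / (1 + c1 t)).
Definition dual_c1 (R : realType) (c0 : R -> R) (t : R) : R :=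
  - (c0 t / (1 + c0 t)).

(* To be applied to the dual curve. *)
Definition ND_dual (R : realType) (b1 c0 c1 : R -> R) : Prop :=
  let al := alpha (b1 0) (c0 0) (c1 0) in
  let be := beta (b1 0) (c0 0) (c1 0) in
  (forall y, al <= y <= be -> dG_dy0 (G1 b1 c1) y < 1) /\
  exists delta0 delta1 : R,
    [/\ is_maximum (delta_ratio (G0 b1 c0) @` `[al, be]) delta0,
        is_maximum (delta_ratio (G1 b1 c1) @` `[al, be]) delta1 &
        derive1 b1 0 * (al + 1)
        + b1 0 * (1 - b1 0) * Num.max 0 (Num.max delta0 delta1) < 0].

Definition condND (R : realType) (b1 c0 c1 : R -> R) : Prop :=
  ND_primal b1 c0 c1 \/ ND_dual (dual_b1 b1) (dual_c0 c1) (dual_c1 c0).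

(* limsup as h -> 0, h <> 0 and x + h in [0, 1], of
   |f (x + h) - f x| / |h| ^ c. *)
Definition limsup_quotient (R : realType) (f : R -> R) (c x : R) : \bar R :=
  limf_esup (fun h : R => (`|f (x + h) - f x| / (`|h| `^ c))%:E)
    (within [set h : R | 0 <= x + h <= 1] (0 : R)^').

Definition difference_quotients (R : realType) (f : R -> R) (c : R)
    (J : set R) : set (\bar R) :=
  [set z | exists x y : R, [/\ J x, J y, y < x &
     z = ((f x - f y) / ((x - y) `^ c))%:E]].

(* Main.v *)
Require Import Defs.
From mathcomp Require Import all_boot all_order all_algebra.
From mathcomp Require Import all_classical all_reals all_analysis.
From mathcomp Require Import ring lra.

(* Only dyadic points matter.  On the dyadic interval I_w of a binary word w,
   the increment of F(t, .) is a product of factors H_i(y) along the orbit y of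
   0 under the maps G_i(t, .), so the increment of f_k over I_w is mu_0(I_w) W(w)
   with W a martingale on the tree of words.  Under (ND) with k = 1 appending a
   digit 0 moves W by a definite amount in one direction and appending a digit 1
   in the other; under (L), W is a coefficient of a product of linear factors,
   and the same holds one order down.  So W leaves every bounded interval within
   a bounded number of digits, whence it is unbounded along mu_0-almost every
   point.  If 1/b_1 - 2 is a common fixed point of G_0 and G_1, then
   mu_0(I_w) is comparable to |I_w| and c = 1 works.  Otherwise two consecutive
   digits are never both nearly fair, so that the sums of sqrt(mu_0(I_w)) over
   words of length n grow more slowly than 2^(n/2); hence mu_0(I_w) >= |I_w|^c'
   for some c' < 1 outside an exponentially small mass, and any c in (c', 1)
   works.  One-sided unboundedness in (ii) follows since the increment over one
   interval is the sum of the increments over its descendants, of which the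
   negligible ones contribute almost nothing. *)

Set Implicit Arguments.
Unset Strict Implicit.
Unset Printing Implicit Defensive.

Import Order.TTheory GRing.Theory Num.Theory.
Import numFieldNormedType.Exports.

Local Open Scope classical_set_scope.
Local Open Scope ring_scope.

(** * Binary words and martingales on the binary tree *)

(** The exponent is fixed by the masses of mu_0 alone: |I_w| ^ c = (tau / 2) ^ n for words of length
    n, that is c = 1 - log_2 tau, and tau involves no derivative of F in t. This is why one c serves
    every k. No value of f_k off the dyadic points is computed. If the increment over I_w is large,
    one of its endpoints is far from f_k(x), whatever f_k(x) may be, and that endpoint supplies h.
    At a dyadic point F(t, .) is a rational function of the parameters. For (ii) the lower bound on
    typical masses is not enough, because the sum over descendants also contains the words of
    exceptionally small mass, where W might be huge. Hence W is also shown to grow subexponentially,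
    which loses against the exponential decay of the exceptional mass. Square roots of masses enter
    because sqrt p + sqrt (1 - p) <= sqrt 2 with equality only at p = 1/2, so every unfair digit is
    a gain. *)

(* Words list binary digits from the last one to the first, so that subdividing
   an interval conses a digit and [v ++ w] is a descendant of [w]. *)
Fixpoint words (n : nat) : seq (seq bool) :=
  if n is n'.+1 then map (cons false) (words n') ++ map (cons true) (words n')
  else [:: [::]].

Lemma big_words0 (R : realType) (P : pred (seq bool)) (F : seq bool -> R) :
  \sum_(w <- words 0 | P w) F w = (if P [::] then F [::] else 0).
Proof. by rewrite /= big_cons big_nil; case: ifP; rewrite ?addr0. Qed.

Lemma big_wordsS (R : realType) n (P : pred (seq bool)) (F : seq bool -> R) :
  \sum_(w <- words n.+1 | P w) F w =
  \sum_(w <- words n)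
    ((if P (false :: w) then F (false :: w) else 0) +
     (if P (true :: w) then F (true :: w) else 0)).
Proof.
by rewrite big_mkcond /= big_cat !big_map big_split.
Qed.

Lemma big_wordsD (R : realType) m n (F : seq bool -> R) :
  \sum_(w <- words (m + n)) F w =
  \sum_(w <- words n) \sum_(v <- words m) F (v ++ w).
Proof.
elim: m F => [|m IH] F.
  by rewrite add0n; apply: eq_bigr => w _; rewrite big_words0.
rewrite addSn big_wordsS /= -[LHS]/(\sum_(w <- words (m + n)) (F (false :: w) + F (true :: w))).
rewrite (IH (fun w => F (false :: w) + F (true :: w))).
by apply: eq_bigr => w _; rewrite big_wordsS.
Qed.

Lemma mem_words n w : (w \in words n) = (size w == n).
Proof.
elim: n w => [|n IH] [|i w]; rewrite /= ?inE //.
  by apply/negbTE; rewrite mem_cat negb_or; apply/andP; split; apply/negP => /mapP[].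
rewrite mem_cat eqSS -IH.
have inj j : injective (@cons bool j) by move=> a b [].
case: i; rewrite ?mem_map //.
  by case: (boolP (_ \in map (cons false) _)) => // /mapP[].
by case: (boolP (_ \in map (cons true) _)) => [/mapP[]//|]; rewrite orbF.
Qed.

Lemma uniq_words n : uniq (words n).
Proof.
elim: n => //= n IH.
have inj j : injective (@cons bool j) by move=> a b [].
rewrite cat_uniq !map_inj_uniq // IH andbT /=.
by apply/hasPn => w /mapP[v _ ->]; apply/negP => /mapP[].
Qed.

(** * Dyadic intervals and the coding of points *)

Section Dyadic.
Variable R : realType.
Implicit Types (w v : seq bool) (x : R).

Fixpoint lft w : R :=
  if w is i :: w' then lft w' + (if i then 2^-1 ^+ (size w) else 0) else 0.

Definition rgt w : R := lft w + 2^-1 ^+ size w.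

Lemma half_gt0 : 0 < 2^-1 :> R. Proof. by rewrite invr_gt0 ltr0n. Qed.

Lemma halfX_gt0 n : 0 < 2^-1 ^+ n :> R.
Proof. by rewrite exprn_gt0 // half_gt0. Qed.

Lemma halfXS n : 2^-1 ^+ n = 2^-1 ^+ n.+1 + 2^-1 ^+ n.+1 :> R.
Proof. rewrite exprS; lra. Qed.

Lemma lft_false w : lft (false :: w) = lft w.
Proof. by rewrite /= addr0. Qed.

Lemma lft_true w : lft (true :: w) = rgt (false :: w).
Proof. by rewrite /rgt lft_false. Qed.

Lemma rgt_true w : rgt (true :: w) = rgt w.
Proof. by rewrite /rgt /= (halfXS (size w)) addrA. Qed.

Lemma lft_true_false i w :
  lft (i :: w) = lft w + if i then 2^-1 ^+ (size w).+1 else 0.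
Proof. by []. Qed.

Lemma lft_lt_rgt w : lft w < rgt w.
Proof. by rewrite /rgt ltrDl halfX_gt0. Qed.

Lemma lft_rgt_cat v w : lft w <= lft (v ++ w) /\ rgt (v ++ w) <= rgt w.
Proof.
elim: v => //= i v [IHl IHr].
have := halfXS (size (v ++ w)); have := halfX_gt0 (size (v ++ w)).+1.
by case: i; rewrite /rgt /= in IHr *; lra.
Qed.

Lemma lft_ge0 w : 0 <= lft w.
Proof. by have [] := lft_rgt_cat w [::]; rewrite cats0. Qed.

Lemma rgt_le1 w : rgt w <= 1.
Proof. by have [_] := lft_rgt_cat w [::]; rewrite cats0 /rgt /= expr0 add0r. Qed.

(* The word [w] of length [n] with [lft w < x <= rgt w], for [0 < x <= 1]. *)
Fixpoint coding n x : seq bool :=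
  if n is n'.+1 then (rgt (false :: coding n' x) < x) :: coding n' x
  else [::].

Lemma size_coding n x : size (coding n x) = n.
Proof. by elim: n => //= n ->. Qed.

Lemma codingP w x : 0 < x <= 1 ->
  (coding (size w) x == w) = (lft w < x <= rgt w).
Proof.
move=> x01; elim: w => [|i w IH].
  by rewrite eqxx /rgt /= expr0 add0r x01.
have h2 := halfXS (size w); have h0 := halfX_gt0 (size w).+1.
rewrite [coding _ _]/= eqseq_cons IH lft_true_false /rgt.
case: (eqVneq (coding (size w) x) w) IH => [->|_] /esym IH; last first.
  rewrite IH andbF; apply/esym/negbTE/negP => /andP[a1 a2].
  move/negP: IH; apply; apply/andP; rewrite /rgt.
  by split; case: i a1 a2 => /=; lra.
move: IH; rewrite /rgt => IH; rewrite IH andbT; case/andP: IH => a1 a2.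
case: i => /=; rewrite ?eqb_id ?eqbF_neg -?leNgt ?addr0.
  by apply/idP/andP => [|[]]; [split|]; lra.
by rewrite a1.
Qed.

Lemma coding_itv n x : 0 < x <= 1 ->
  lft (coding n x) < x <= rgt (coding n x).
Proof. by move=> x01; rewrite -codingP // size_coding. Qed.

Lemma drop_coding m n x : drop m (coding (m + n) x) = coding n x.
Proof. by elim: m => [|m IH]; rewrite ?drop0 // addSn /= IH. Qed.

End Dyadic.

Arguments lft {R} w.
Arguments rgt {R} w.


(** * Growth of oscillating martingales *)

Section MartingaleGrowth.
Variables (R : realType) (mu W : seq bool -> R).
Implicit Types (w v : seq bool).

(** A probability on the tree in which every digit has conditional probability at least [eta],
    whatever the past; this uniformity makes all escape estimates below uniform in the word. *)
Definition mass_tree (eta : R) :=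
  [/\ mu [::] = 1, 0 < eta < 1,
      forall w, mu w = mu (false :: w) + mu (true :: w) &
      forall i w, eta * mu w <= mu (i :: w)].

Definition martingale_on :=
  forall w, mu w * W w =
    mu (false :: w) * W (false :: w) + mu (true :: w) * W (true :: w).

Definition oscillating_by l (d : R) (U : seq bool -> R) :=
  forall w, exists2 v, size v = l & d <= `|U (v ++ w) - U w|.

Definition oscillating (U : seq bool -> R) :=
  exists l (d : R), 0 < d /\ oscillating_by l d U.

(** Every rate [lam > 1] is allowed because the decay rate that [U] has to lose against is known
    only to be below 1. *)
Definition subexponential (U : seq bool -> R) :=
  forall lam : R, 1 < lam -> exists2 C, 0 <= C & forall w, `|U w| <= C * lam ^+ size w.

Variable eta : R.
Hypothesis mu_tree : mass_tree eta.

Lemma mass_gt0 w : 0 < mu w.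
Proof.
have [m1 /andP[e0 _] _ h] := mu_tree.
elim: w => [|i w IH]; first by rewrite m1.
by apply: lt_le_trans (h i w); rewrite mulr_gt0.
Qed.

Lemma mass_sum n w : \sum_(v <- words n) mu (v ++ w) = mu w.
Proof.
have [_ _ h _] := mu_tree.
elim: n => [|n IH]; first by rewrite big_words0.
by rewrite big_wordsS -[RHS]IH; apply: eq_bigr => v _; rewrite [RHS]h.
Qed.

Lemma mass_cat v w : eta ^+ size v * mu w <= mu (v ++ w).
Proof.
have [_ /andP[e0 _] _ h] := mu_tree.
elim: v => [|i v IH]; first by rewrite mul1r.
apply: le_trans (h i (v ++ w)); rewrite /= exprS -mulrA ler_pM2l //.
Qed.

Hypothesis W_mart : martingale_on.

Lemma martingale_sum n w :
  \sum_(v <- words n) mu (v ++ w) * W (v ++ w) = mu w * W w.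
Proof.
elim: n => [|n IH]; first by rewrite big_words0.
by rewrite big_wordsS -[RHS]IH; apply: eq_bigr => v _; rewrite [RHS]W_mart.
Qed.

End MartingaleGrowth.

Lemma subexponentialN (R : realType) (U : seq bool -> R) :
  subexponential U -> subexponential (fun w => - U w).
Proof. by move=> h lam /h[C C0 HC]; exists C => // w; rewrite normrN. Qed.

Lemma oscillating_byN (R : realType) l (d : R) (U : seq bool -> R) :
  oscillating_by l d U -> oscillating_by l d (fun w => - U w).
Proof.
move=> h w; have [v sv hv] := h w; exists v => //.
by rewrite -opprD normrN.
Qed.

Lemma oscillatingN (R : realType) (U : seq bool -> R) :
  oscillating U -> oscillating (fun w => - U w).
Proof. by case=> l [d [d0 h]]; exists l, d; split => //; exact: oscillating_byN. Qed.

Lemma martingale_onN (R : realType) (mu W : seq bool -> R) :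
  martingale_on mu W -> martingale_on mu (fun w => - W w).
Proof. by move=> h w; rewrite !mulrN h opprD. Qed.

Section Oscillation.
Variables (R : realType) (mu : seq bool -> R) (eta : R).
Hypothesis mu_tree : mass_tree mu eta.

(* A martingale cannot only move in one direction: a descent of size [d] along
   one word forces an ascent of size at least [eta ^ l * d] along another. *)
Lemma oscillating_up (W : seq bool -> R) l (d : R) :
  martingale_on mu W -> 0 < d -> oscillating_by l d W ->
  forall w, exists2 v, size v = l & W w + eta ^+ l * d / 2 <= W (v ++ w).
Proof.
move=> W_mart d0 osc w.
have [_ /andP[e0 e1] _ _] := mu_tree.
have el0 : 0 < eta ^+ l by rewrite exprn_gt0.
have el1 : eta ^+ l <= 1 by rewrite exprn_ile1 // ltW.
have ed0 : 0 < eta ^+ l * d by rewrite mulr_gt0.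
have [v sv] := osc w.
case: (leP 0 (W (v ++ w) - W w)) => [p|n].
  rewrite ger0_norm // => h; exists v => //.
  have : eta ^+ l * d <= d by rewrite ger_pMl.
  lra.
rewrite ltr0_norm // => h.
apply: contrapT => nex.
have all_lt u : u \in words l -> W (u ++ w) - W w <= eta ^+ l * d / 2.
  rewrite mem_words => /eqP su; rewrite leNgt; apply/negP => lt.
  by apply: nex; exists u => //; lra.
have vw : v \in words l by rewrite mem_words sv.
have s0 : \sum_(u <- words l) mu (u ++ w) * (W (u ++ w) - W w) = 0.
  under eq_bigr do rewrite mulrBr.
  by rewrite sumrB (martingale_sum W_mart) -mulr_suml (mass_sum mu_tree) subrr.
(* If no ascent existed, these gaps would be nonnegative with mean [eta ^+ l * d / 2]; but the gap
   at [v] exceeds [d] and has conditional mass at least [eta ^+ l], which is already twice too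
   much. *)
have s1 : \sum_(u <- words l) mu (u ++ w) * (eta ^+ l * d / 2 - (W (u ++ w) - W w))
    = mu w * (eta ^+ l * d / 2).
  under eq_bigr do rewrite mulrBr.
  by rewrite sumrB s0 subr0 -mulr_suml (mass_sum mu_tree).
have : mu (v ++ w) * (eta ^+ l * d / 2 - (W (v ++ w) - W w)) <= mu w * (eta ^+ l * d / 2).
  rewrite -s1 (bigD1_seq v) ?uniq_words //= lerDl big_seq_cond.
  apply: sumr_ge0 => u /andP[uw _].
  apply: mulr_ge0; first exact: ltW (mass_gt0 mu_tree _).
  by rewrite subr_ge0 all_lt.
have mv := mass_cat mu_tree v w; rewrite sv in mv.
have mw := mass_gt0 mu_tree w.
have : eta ^+ l * mu w * (eta ^+ l * d / 2 + d) <=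
       mu (v ++ w) * (eta ^+ l * d / 2 - (W (v ++ w) - W w)).
  apply: ler_pM => //; [by rewrite mulr_ge0 // ltW|lra|lra].
have : 0 < mu w * (eta ^+ l * d) by rewrite mulr_gt0.
have : 0 < eta ^+ l * mu w * (eta ^+ l * d) by rewrite !mulr_gt0.
lra.
Qed.

Lemma archimedean_mul (K d : R) : 0 < d -> exists n, K <= n%:R * d.
Proof.
move=> d0; exists (Num.bound (`|K| / d)).
rewrite -ler_pdivrMr // (le_trans (ler_norm _)) // normrM normfV (gtr0_norm d0).
by rewrite ltW // archi_boundP // divr_ge0 // ltW.
Qed.

Lemma climb (W : seq bool -> R) l (d : R) :
  (forall w, exists2 v, size v = l & W w + d <= W (v ++ w)) ->
  forall n w, exists2 v, size v = (n * l)%N & W w + n%:R * d <= W (v ++ w).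
Proof.
move=> up; elim=> [|n IH] w; first by exists [::]; rewrite // mul0r addr0.
have [v sv Wv] := IH w; have [u su Wu] := up (v ++ w).
exists (u ++ v); first by rewrite size_cat su sv mulSn.
rewrite -catA -natr1; lra.
Qed.

Lemma oscillating_ge (W : seq bool -> R) (K : R) w :
  martingale_on mu W -> oscillating W -> exists v, K <= W (v ++ w).
Proof.
move=> mW [l [d [d0 oW]]].
have up := oscillating_up mW d0 oW.
have [_ /andP[e0 _] _ _] := mu_tree.
have [n hn] : exists n, K - W w <= n%:R * (eta ^+ l * d / 2).
  by apply: archimedean_mul; rewrite divr_gt0 // mulr_gt0 ?exprn_gt0.
by have [v _ hv] := climb up n w; exists v; lra.
Qed.

(** Moving away from 0, upwards or downwards according to the sign of [W w], makes the number of
    digits depend on [K] only and not on [w]. *)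
Lemma oscillating_abs_ge (W : seq bool -> R) (K : R) :
  martingale_on mu W -> oscillating W -> exists l,
  forall w, exists2 v, size v = l & K <= `|W (v ++ w)|.
Proof.
move=> mW [l [d [d0 oW]]].
have up := oscillating_up mW d0 oW.
have dn := oscillating_up (martingale_onN mW) d0 (oscillating_byN oW).
have [_ /andP[e0 _] _ _] := mu_tree.
have [n hn] : exists n, K <= n%:R * (eta ^+ l * d / 2).
  by apply: archimedean_mul; rewrite divr_gt0 // mulr_gt0 ?exprn_gt0.
exists (n * l)%N => w.
have [p|q] := leP 0 (W w).
  have [v sv hv] := climb up n w; exists v => //.
  by rewrite (le_trans _ (ler_norm _)) //; lra.
have [v sv hv] := climb dn n w; exists v => //.
by rewrite -normrN (le_trans _ (ler_norm _)) //; lra.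
Qed.

End Oscillation.

(** * De Rham functions on dyadic intervals *)

Section DeRhamMasses.
Variables (R : realType) (b u v : R).
Implicit Types (w : seq bool) (y : R).

Definition Gdigit (i : bool) y : R :=
  if i then ((1 - b + v) * y + v) / (b * y + 1) else b * (1 + u) * y + u.

(** The conditional mass of the digit [i]. Since F(1/2) = b, [Hdigit false y] is the value at b of
    the Moebius map [moebius01 y] introduced below. *)
Definition Hdigit (i : bool) y : R :=
  if i then (1 - b) / (b * y + 1) else b * (1 + y) / (b * y + 1).

Fixpoint node w : R := if w is i :: w' then Gdigit i (node w') else 0.

Fixpoint mass w : R :=
  if w is i :: w' then mass w' * Hdigit i (node w') else 1.

Fixpoint cumul w : R :=
  if w is i :: w' then
    cumul w' + (if i then mass w' * Hdigit false (node w') else 0)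
  else 0.

Definition admissible :=
  [/\ 0 < b < 1, b - 1 < u < b^-1 - 1 & - b < v < b / (1 - b)].

Hypothesis adm : admissible.

Lemma admissible_mul :
  [/\ 0 < b < 1, b < 1 + u, b * (1 + u) < 1, 1 - b < 1 + v &
      (1 + v) * (1 - b) < 1].
Proof.
have [/andP[b0 b1] /andP[u1 u2] /andP[v1 v2]] := adm.
split; [exact/andP|lra| |lra|].
  have : b * (1 + u) < b * b^-1 by rewrite ltr_pM2l //; lra.
  by rewrite divff ?gt_eqF.
have c0 : 0 < 1 - b by lra.
move: v2; rewrite ltr_pdivlMr //; lra.
Qed.

Let al := alpha b u v.
Let be := beta b u v.

Lemma alpha_beta_bounds :
  [/\ -1 < al, al <= 0, 0 <= be,
      al <= u / (1 - b * (1 + u)) <= be & al <= v / b <= be].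
Proof.
have [/andP[b0 b1] u1 u2 v1 v2] := admissible_mul.
rewrite /al /be /alpha /beta !lt_min !ge_min !le_max !lexx !orbT; split => //.
apply/and3P; split; first lra.
  by rewrite ltr_pdivlMr; nra.
by rewrite ltr_pdivlMr; lra.
Qed.

Lemma den_gt0 y : al <= y -> 0 < b * y + 1.
Proof.
have [/andP[b0 b1] _ _ _ _] := admissible_mul.
have [a1 _ _ _ _] := alpha_beta_bounds => ay; nra.
Qed.

(** The ends of [[al, be]] are taken among 0 and the fixed points [u / (1 - b * (1 + u))] and
    [v / b] of the two maps. Each map sends [y] to a convex combination of [y] and its fixed point;
    for digit 1 the weight [(1 - b) / (b * y + 1)] is at most 1 because [y > -1]. *)
Lemma Gdigit_in i y : al <= y <= be -> al <= Gdigit i y <= be.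
Proof.
have [/andP[b0 b1] u1 u2 v1 v2] := admissible_mul.
have [a1 a0 be0 p0 p1] := alpha_beta_bounds.
move=> /andP[ay yb].
have d0 := den_gt0 ay.
have conv (s p : R) : 0 <= s <= 1 -> al <= p <= be ->
    al <= s * y + (1 - s) * p <= be.
  move=> /andP[s0 s1] /andP[ap pb].
  have t0 : 0 <= 1 - s by lra.
  have := ler_wpM2l s0 ay; have := ler_wpM2l s0 yb.
  have := ler_wpM2l t0 ap; have := ler_wpM2l t0 pb.
  by move=> *; apply/andP; split; lra.
case: i => /=.
  have -> : ((1 - b + v) * y + v) / (b * y + 1) =
      ((1 - b) / (b * y + 1)) * y + (1 - (1 - b) / (b * y + 1)) * (v / b).
    by field; rewrite !gt_eqF.
  apply: conv => //; rewrite divr_ge0 ?ler_pdivrMr //; [nra|lra|lra].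
have -> : b * (1 + u) * y + u =
    (b * (1 + u)) * y + (1 - b * (1 + u)) * (u / (1 - b * (1 + u))).
  by field; rewrite gt_eqF //; lra.
by apply: conv => //; apply/andP; split; nra.
Qed.

Lemma node_in w : al <= node w <= be.
Proof.
have [_ a0 be0 _ _] := alpha_beta_bounds.
by elim: w => [|i w IH]; [apply/andP|exact: Gdigit_in].
Qed.

Lemma node_den_gt0 w : 0 < b * node w + 1.
Proof. by have /andP[h _] := node_in w; exact: den_gt0. Qed.

Lemma Hdigit_sum y : al <= y -> Hdigit false y + Hdigit true y = 1.
Proof. by move=> /den_gt0 h; rewrite /Hdigit; field; rewrite gt_eqF. Qed.

Lemma mass_mass_tree : exists eta, mass_tree mass eta.
Proof.
have [/andP[b0 b1] _ _ _ _] := admissible_mul.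
have [a1 a0 be0 _ _] := alpha_beta_bounds.
have D0 : 1 <= b * be + 1 by nra.
have D1 : 0 < b * be + 1 by lra.
pose m := Num.min (b * (1 + al)) (1 - b).
have m0 : 0 < m by rewrite lt_min; apply/andP; split; [rewrite mulr_gt0 //|]; lra.
have [m1 m2] : m <= b * (1 + al) /\ m <= 1 - b by rewrite !ge_min !lexx orbT.
have lowH i y : al <= y <= be -> m / (b * be + 1) <= Hdigit i y.
  move=> /andP[ay yb]; have d0 := den_gt0 ay.
  have dle : (b * be + 1)^-1 <= (b * y + 1)^-1.
    by rewrite lef_pV2 ?posrE //; nra.
  have i0 : 0 <= (b * be + 1)^-1 by rewrite invr_ge0 ltW.
  by case: i; rewrite /Hdigit; apply: ler_pM => //; nra.
have mass_ge0 w : 0 <= mass w.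
  elim: w => //= i w IH; rewrite mulr_ge0 //.
  by apply: le_trans (lowH i _ (node_in w)); rewrite divr_ge0 // ltW.
exists (m / (b * be + 1)); split => //.
- rewrite divr_gt0 //= ltr_pdivrMr //; nra.
- move=> w /=; rewrite -mulrDr Hdigit_sum ?mulr1 //.
  by case/andP: (node_in w).
- by move=> i w /=; rewrite mulrC; apply: ler_wpM2l => //; exact: lowH (node_in w).
Qed.

(* The distribution function restricted to a dyadic interval and rescaled is
   this Moebius map, with [y] the value of [node] there. *)
Definition moebius01 (y z : R) : R := z * (1 + y) / (y * z + 1).

Section Solution.
Variable f : R -> R.
Hypothesis hf : deRham_solution (mx22 (b * (1 + u)) 0 u 1)
                                (mx22 (1 - b + v) b v 1) f.

Lemma Phi_mx22 (m00 m01 m10 m11 z : R) :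
  Phi (mx22 m00 m01 m10 m11) z = (m00 * z + m01) / (m10 * z + m11).
Proof. by rewrite /Phi !mxE. Qed.

Lemma deRham_0 : f 0 = 0.
Proof.
have [/andP[b0 b1] u1 u2 v1 v2] := admissible_mul.
have [_ f01 e0 _] := hf.
have /andP[z0 z1] : 0 <= f 0 <= 1 by apply: f01; rewrite lexx ler01.
have := e0 0; rewrite mulr0 lexx invr_ge0 ler0n => /(_ isT).
rewrite Phi_mx22 => E.
have d0 : 0 < u * f 0 + 1 by nra.
(* This is the factor left when the fixed-point equation at 0 is divided by [f 0]; its positivity on
   [0, 1] leaves 0 as the only solution. *)
have d1 : 0 < u * f 0 + 1 - b * (1 + u) by nra.
have : f 0 * (u * f 0 + 1) = b * (1 + u) * f 0.
  by rewrite {1}E addr0 divfK // gt_eqF.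
move=> E2; apply/eqP; have : f 0 * (u * f 0 + 1 - b * (1 + u)) == 0.
  by apply/eqP; rewrite mulrBr E2; ring.
by rewrite mulf_eq0 => /orP[//|]; rewrite gt_eqF.
Qed.

Lemma deRham_1 : f 1 = 1.
Proof.
have [/andP[b0 b1] u1 u2 v1 v2] := admissible_mul.
have [_ f01 _ e1] := hf.
have /andP[z0 z1] : 0 <= f 1 <= 1 by apply: f01; rewrite lexx ler01.
have := e1 1; rewrite invf_le1 // ler1n lexx => /(_ isT).
rewrite (_ : 2 * 1 - 1 = 1 :> R); last by ring.
rewrite Phi_mx22 => E.
have d0 : 0 < v * f 1 + 1 by nra.
have d1 : 0 < v * f 1 + b by nra.
have : f 1 * (v * f 1 + 1) = (1 - b + v) * f 1 + b.
  by rewrite {1}E divfK // gt_eqF.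
move=> E2; apply/eqP; rewrite -subr_eq0.
have : (f 1 - 1) * (v * f 1 + b) == 0.
  by apply/eqP; rewrite -[RHS](subrr (f 1 * (v * f 1 + 1))) [X in _ = _ - X]E2; ring.
by rewrite mulf_eq0 => /orP[//|]; rewrite gt_eqF.
Qed.

(** The maps [moebius01 y] fix 0 and 1. Composing one with the Moebius map of a digit and
    renormalising the image to [0, 1] gives another one, with parameter [Gdigit i y]; a single
    number thus records the shape of F on a dyadic interval. *)
Lemma deRham_dyadic w x : 0 <= x <= 1 ->
  f (lft w + 2^-1 ^+ size w * x) = cumul w + mass w * moebius01 (node w) (f x).
Proof.
have [/andP[b0 b1] u1 u2 v1 v2] := admissible_mul.
have [_ f01 e0 e1] := hf.
elim: w x => [|i w IH] x x01.
  by rewrite /moebius01 /= expr0 mul1r !add0r mul0r addr0 add0r mul1r mulr1 divr1.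
have /andP[z0 z1] := f01 _ x01.
have /andP[oa _] := node_in w; have d0 := node_den_gt0 w.
have [a1 _ _ _ _] := alpha_beta_bounds.
have y1 : -1 < node w by lra.
have /andP[oia _] := node_in (i :: w).
have y'1 : -1 < node (i :: w) by lra.
have den (y z : R) : -1 < y -> 0 <= z <= 1 -> 0 < y * z + 1.
  move=> h /andP[z0' z1']; have [->|zN0] := eqVneq z 0; first lra.
  have : 0 < (y + 1) * z by rewrite mulr_gt0 ?lt_def ?zN0 //; lra.
  lra.
have := den _ _ y'1 (f01 _ x01).
case: i y'1 {oia} => /= y'1 D.
  (* Position [x] in the half is position [(1 + x) / 2] in the parent, where the functional equation
     applies. *)
  rewrite (_ : _ + _ = lft w + 2^-1 ^+ size w * ((1 + x) / 2)); last first.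
    by rewrite exprS; field.
  have hx : 0 <= (1 + x) / 2 <= 1 by lra.
  rewrite IH // e1; last by lra.
  rewrite (_ : 2 * ((1 + x) / 2) - 1 = x); last by field.
  have vz : 0 < v * f x + 1 by apply: den (f01 _ x01); lra.
  have {}D : 0 < ((1 - b + v) * node w + v) * f x + (b * node w + 1).
    rewrite (_ : _ + _ = (((1 - b + v) * node w + v) / (b * node w + 1) * f x + 1)
      * (b * node w + 1)); first exact: mulr_gt0.
    by field; rewrite gt_eqF.
  rewrite Phi_mx22 /moebius01 /Hdigit.
  by field; rewrite !gt_eqF //=; lra.
rewrite (_ : _ + _ = lft w + 2^-1 ^+ size w * (x / 2)); last first.
  by rewrite exprS; field.
have hx : 0 <= x / 2 <= 1 by lra.
rewrite IH // e0; last by lra.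
rewrite (_ : 2 * (x / 2) = x); last by field.
have uz : 0 < u * f x + 1 by apply: den (f01 _ x01); lra.
rewrite Phi_mx22 /moebius01 /Hdigit.
by field; rewrite !gt_eqF //=; lra.
Qed.

Lemma deRham_lft w : f (lft w) = cumul w.
Proof.
have := @deRham_dyadic w 0; rewrite deRham_0 /moebius01 lexx ler01 => /(_ isT).
by rewrite !(mulr0, mul0r, addr0).
Qed.

Lemma deRham_rgt w : f (rgt w) = cumul w + mass w.
Proof.
have := @deRham_dyadic w 1; rewrite deRham_1 /moebius01 lexx ler01 => /(_ isT).
rewrite !mulr1 mul1r [1 + _]addrC divff ?mulr1 //.
rewrite gt_eqF //; have [a1 _ _ _ _] := alpha_beta_bounds.
have /andP[oa _] := node_in w; lra.
Qed.

End Solution.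

End DeRhamMasses.

(** * Sets described by binary digits *)

Section CodedSets.
Variable R : realType.
Implicit Types (w : seq bool) (P : pred (seq bool)).

Definition coded n P : set R := [set x | 0 < x <= 1 /\ P (coding n x)].

Variables (nu : {measure set (measurableTypeR R) -> \bar R}) (m : seq bool -> R).
Hypothesis nu_itv : forall w, nu `]lft w, rgt w]%classic = (m w)%:E.

Lemma itv_rgt01 w (x : R) : lft w < x <= rgt w -> 0 < x <= 1.
Proof.
move=> /andP[h1 h2]; rewrite (le_lt_trans (lft_ge0 R w) h1).
exact: le_trans h2 (rgt_le1 R w).
Qed.

(** Half-open cells of one level are disjoint, so their measures add up. The measure is kept
    abstract because it is mu_0 in some applications and Lebesgue measure in others. *)
Lemma coded_mem_measure n s : uniq s -> {subset s <= words n} ->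
  measurable (coded n (mem s) : set (measurableTypeR R)) /\
  nu (coded n (mem s)) = (\sum_(w <- s) m w)%:E.
Proof.
elim: s => [|w s IH] /= us sub.
  have -> : coded n (mem [::]) = set0.
      by rewrite -subset0 => x [].
  by rewrite measure0 big_nil.
case/andP: us => wNs us.
have [|ms es] := IH us; first by move=> v vs; apply: sub; rewrite inE vs orbT.
have sw : size w = n by apply/eqP; rewrite -mem_words sub // inE eqxx.
have -> : coded n (mem (w :: s)) = `]lft w, rgt w]%classic `|` coded n (mem s).
  apply/seteqP; split => x.
    move=> [x01]; rewrite inE => /orP[/eqP e|]; last by right; split.
    by left; rewrite /= in_itv /= -codingP // sw e.
  case=> [|[x01 h]]; last by split => //; rewrite inE; apply/orP; right.
  rewrite /= in_itv /= => h; have x01 := itv_rgt01 h.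
  by move: h; rewrite -codingP // sw => /eqP e; split => //=; rewrite e mem_head.
split; first by apply: measurableU => //; exact: measurable_itv.
rewrite measureU //; last first.
  rewrite -subset0 => x [] /=; rewrite in_itv /= => h [x01].
  move: h; rewrite -codingP // sw => /eqP ->; exact/negP.
by rewrite big_cons EFinD; congr (_ + _)%E; [exact: nu_itv|exact: es].
Qed.

Lemma coded_filter n P : coded n P = coded n (mem [seq w <- words n | P w]).
Proof.
apply/seteqP; split => x [x01 h]; split => //.
  by rewrite /= mem_filter mem_words size_coding eqxx andbT.
by move: h; rewrite /= mem_filter => /andP[].
Qed.

Lemma measurable_coded n P : measurable (coded n P : set (measurableTypeR R)).
Proof.
rewrite coded_filter.
have [] // := @coded_mem_measure n [seq w <- words n | P w].
  exact: filter_uniq (uniq_words n).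
by move=> w; rewrite mem_filter => /andP[].
Qed.

Lemma coded_measure n P : nu (coded n P) = (\sum_(w <- words n | P w) m w)%:E.
Proof.
rewrite coded_filter -big_filter.
have [] // := @coded_mem_measure n [seq w <- words n | P w].
  exact: filter_uniq (uniq_words n).
by move=> w; rewrite mem_filter => /andP[].
Qed.

End CodedSets.

Lemma lebesgue_dyadic (R : realType) w :
  @lebesgue_measure R `]lft w, rgt w]%classic = (2^-1 ^+ size w)%:E.
Proof.
by rewrite lebesgue_measure_itv /= lte_fin lft_lt_rgt -EFinB /rgt addrAC subrr add0r.
Qed.

(** * Null sets and a geometric Borel-Cantelli lemma *)

Section AlmostSure.
Variables (R : realType) (nu : {measure set (measurableTypeR R) -> \bar R}).

Lemma negligible_small (A : set R) :
  (forall e : R, 0 < e -> exists B : set (measurableTypeR R),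
     [/\ measurable B, A `<=` B & (nu B <= e%:E)%E]) ->
  nu.-negligible A.
Proof.
move=> h.
have hn n : exists B : set (measurableTypeR R),
    [/\ measurable B, A `<=` B & (nu B <= (n.+1%:R^-1)%:E)%E].
  by apply: h; rewrite invr_gt0.
have [B HB] := choice hn.
exists (\bigcap_n B n); split.
- by apply: bigcapT_measurable => n; have [] := HB n.
- apply/eqP; rewrite eq_le measure_ge0 andbT; apply/lee_addgt0Pr => e e0.
  rewrite add0e.
  have [n hn'] : exists n, n.+1%:R^-1 <= e.
    exists (Num.bound e^-1); rewrite invf_ple ?posrE //.
    by rewrite ltW // (lt_trans (archi_boundP _)) ?ltr_nat // invr_ge0 ltW.
  have [mB _ lB] := HB n.
  apply: (@le_trans _ _ (nu (B n))); last by apply: le_trans lB _; rewrite lee_fin.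
  apply: le_measure; rewrite ?inE //; last exact: bigcap_inf.
  by apply: bigcapT_measurable => k; have [] := HB k.
- by move=> x Ax n _; have [_ sB _] := HB n; exact: sB.
Qed.

Lemma geometric_lt (C q e : R) : 0 <= q < 1 -> 0 < e -> exists n, C * q ^+ n < e.
Proof.
move=> /andP[q0 q1] e0.
have /cvgrPdist_lt /(_ _ e0) [N _ HN] : (fun n => C * q ^+ n) @ \oo --> (0 : R).
  rewrite -[X in _ --> X](mulr0 C); apply: cvgMr; apply: cvg_expr.
  by rewrite ger0_norm.
exists N; have := HN N (leqnn N) => /=; rewrite sub0r normrN.
exact: le_lt_trans (ler_norm _).
Qed.

Lemma borel_cantelli_geometric (B : nat -> set (measurableTypeR R)) (C q : R) :
  0 <= q < 1 -> 0 <= C ->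
  (forall n, measurable (B n)) -> (forall n, (nu (B n) <= (C * q ^+ n)%:E)%E) ->
  nu (lim_sup_set B) = 0%E.
Proof.
move=> /andP[q0 q1] C0 mB lB; apply: lim_sup_set_cvg0 => //.
apply: (@le_lt_trans _ _ ((C / (1 - q))%:E)); last by rewrite ltry.
apply: lime_le; first by apply: is_cvg_nneseries => n _ _; exact: measure_ge0.
near=> n.
apply: (@le_trans _ _ (\sum_(0 <= k < n) (C * q ^+ k)%:E)%E).
  by apply: lee_sum => k _; exact: lB.
rewrite sumEFin lee_fin -mulr_sumr ler_wpM2l //.
have d : 0 < 1 - q by lra.
rewrite -[leRHS]mul1r ler_pdivlMr // big_mkord.
have := subrX1 q n; have : 0 <= q ^+ n by rewrite exprn_ge0.
lra.
Unshelve. all: by end_near. Qed.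

End AlmostSure.

(** * Mass regimes and almost sure growth *)

Section Regime.
Variables (R : realType) (m : seq bool -> R) (eta : R).
Hypothesis mt : mass_tree m eta.
Implicit Types (w v : seq bool) (W : seq bool -> R).

(** The scale to beat is |I_w| ^ c = (tau / 2) ^ n. In the second case the threshold is
    [tau ^+ 2 / 2] instead of [tau / 2]: on words above it, the mass exceeds the scale by a spare
    factor [tau ^+ n]. The constant [C] may depend on [w], since the estimate is applied below an
    arbitrary word. *)
Definition mass_regime (tau : R) :=
  (tau = 1 /\ exists2 kappa, 0 < kappa &
     forall w, kappa * 2^-1 ^+ size w <= m w) \/
  (1 < tau < 2 /\ exists2 theta, 0 <= theta < 1 &
     forall w, exists2 C, 0 <= C & forall n,
       \sum_(v <- words n | m (v ++ w) < (tau ^+ 2 / 2) ^+ size (v ++ w))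
          m (v ++ w) <= C * theta ^+ n).

Lemma mass_martingale_large (tau : R) W w (K : R) :
  mass_regime tau -> martingale_on m W -> oscillating W -> subexponential W ->
  exists v, K * (tau / 2) ^+ size (v ++ w) <= m (v ++ w) * W (v ++ w).
Proof.
move=> [[-> [kappa k0 lowm]]|[/andP[t1 t2] [theta /andP[th0 th1] bad]]] mW oW sW.
  have [v hv] := oscillating_ge mt (`|K| / kappa) w mW oW.
  exists v; rewrite mul1r.
  apply: (@le_trans _ _ (`|K| * 2^-1 ^+ size (v ++ w))).
    by rewrite ler_wpM2r ?ler_norm // ltW // halfX_gt0.
  apply: (@le_trans _ _ ((kappa * 2^-1 ^+ size (v ++ w)) * (`|K| / kappa))).
    by rewrite le_eqVlt; apply/orP; left; apply/eqP; field; rewrite gt_eqF.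
  apply: ler_pM => //; first by rewrite mulr_ge0 // ltW // halfX_gt0.
  by rewrite divr_ge0 // ltW.
(* Below [w0] the total increment is a fixed positive number. If all descendants had increments of
   at most [K'] times the scale, the heavy ones would contribute O(tau^-n) and the light ones O((lam
   * theta)^n), and their sum would tend to 0. *)
have [v0 W1] := oscillating_ge mt 1 w mW oW.
pose w0 := v0 ++ w; pose s := size w0.
have g0 : 0 < m w0 * W w0.
  by rewrite mulr_gt0 ?(mass_gt0 mt) //; exact: lt_le_trans W1.
pose K' := `|K|.
suff [v hv] : exists v, K' * (tau / 2) ^+ size (v ++ w0) <= m (v ++ w0) * W (v ++ w0).
  exists (v ++ v0); rewrite -catA; apply: le_trans hv.
  by rewrite ler_wpM2r ?ler_norm // exprn_ge0 // divr_ge0 //; lra.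
apply: contrapT => nex.
have small v : m (v ++ w0) * W (v ++ w0) <= K' * (tau / 2) ^+ size (v ++ w0).
  by apply/ltW; rewrite ltNge; apply/negP => h; apply: nex; exists v.
have [C C0 hC] := bad w0.
(* Chosen so that [lam > 1] while [lam * theta < 1]. *)
pose lam := 2 / (1 + theta).
have lam1 : 1 < lam by rewrite /lam ltr_pdivlMr; lra.
have [C' C'0 hC'] := sW lam lam1.
pose q := Num.max tau^-1 (lam * theta).
have ti0 : 0 <= tau^-1 by rewrite invr_ge0; lra.
have q01 : 0 <= q < 1.
  rewrite /q le_max ti0 /= gt_max invf_lt1 ?t1 /=; last lra.
  by rewrite /lam mulrAC ltr_pdivrMr; lra.
have qt : tau^-1 <= q by rewrite /q le_max lexx.
have ql : lam * theta <= q by rewrite /q le_max lexx orbT.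
pose c1 := K' * m w0; pose c2 := C' * C * lam ^+ s.
have c10 : 0 <= c1 by rewrite mulr_ge0 ?normr_ge0 // ltW // (mass_gt0 mt).
have lam0 : 0 <= lam by lra.
have c20 : 0 <= c2 by rewrite !mulr_ge0 // exprn_ge0.
have q0 : 0 <= q by case/andP: q01.
have [n hn] := geometric_lt (c1 + c2) q01 g0.
suff : m w0 * W w0 <= (c1 + c2) * q ^+ n by rewrite leNgt hn.
rewrite -(martingale_sum mW n w0).
have tX0 N : 0 < tau ^+ N by rewrite exprn_gt0 //; lra.
have term v : v \in words n -> m (v ++ w0) * W (v ++ w0) <=
    K' * tau^-1 ^+ n * m (v ++ w0) +
    C' * lam ^+ (n + s) *
     (if m (v ++ w0) < (tau ^+ 2 / 2) ^+ size (v ++ w0) then m (v ++ w0) else 0).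
  rewrite mem_words => /eqP sv.
  have mv := mass_gt0 mt (v ++ w0).
  have svw : size (v ++ w0) = (n + s)%N by rewrite size_cat sv.
  case: ifP => [_|/negbT]; last first.
    rewrite -leNgt mulr0 addr0 => good; apply: le_trans (small v) _.
    rewrite -mulrA ler_wpM2l ?normr_ge0 //.
    apply: (@le_trans _ _ (tau^-1 ^+ (n + s) * m (v ++ w0))).
      apply: (@le_trans _ _ (tau^-1 ^+ (n + s) * (tau ^+ 2 / 2) ^+ size (v ++ w0))).
        rewrite svw -exprMn; apply: lerXn2r; rewrite ?nnegrE.
        - by rewrite divr_ge0 //; lra.
        - by rewrite mulr_ge0 // divr_ge0 // exprn_ge0; lra.
        - by rewrite le_eqVlt; apply/orP; left; apply/eqP; field; rewrite gt_eqF //; lra.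
      by rewrite ler_wpM2l // exprn_ge0.
    rewrite ler_wpM2r ?(ltW mv) // exprD ger_pMr ?exprn_gt0 ?invr_gt0 //; last lra.
    by rewrite exprn_ile1 // invf_le1; lra.
  apply: (@le_trans _ _ (C' * lam ^+ (n + s) * m (v ++ w0))).
    rewrite mulrC ler_wpM2r ?(ltW mv) //.
    by apply: le_trans (ler_norm _) _; rewrite -svw; exact: hC'.
  by rewrite lerDr !mulr_ge0 ?normr_ge0 ?exprn_ge0 // ltW.
apply: (@le_trans _ _ (\sum_(v <- words n) (K' * tau^-1 ^+ n * m (v ++ w0) +
    C' * lam ^+ (n + s) *
     (if m (v ++ w0) < (tau ^+ 2 / 2) ^+ size (v ++ w0) then m (v ++ w0) else 0)))).
  by rewrite big_seq [leRHS]big_seq; apply: ler_sum.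
rewrite big_split -!mulr_sumr /= (mass_sum mt) -big_mkcond /= mulrDl lerD //.
  by rewrite /c1 mulrAC ler_wpM2l //; apply: lerXn2r.
apply: (@le_trans _ _ (C' * lam ^+ (n + s) * (C * theta ^+ n))).
  by rewrite ler_wpM2l // mulr_ge0 // exprn_ge0.
have -> : C' * lam ^+ (n + s) * (C * theta ^+ n) = c2 * (lam * theta) ^+ n.
  by rewrite /c2 exprD [(lam * theta) ^+ n]exprMn; ring.
rewrite ler_wpM2l //; apply: lerXn2r => //; rewrite nnegrE //.
by rewrite mulr_ge0.
Qed.

End Regime.

Section AlmostSureGrowth.
Variables (R : realType) (mu0 : probability (measurableTypeR R) R).
Variables (m : seq bool -> R) (eta : R).
Hypothesis mt : mass_tree m eta.
Hypothesis mu0_itv : forall w, mu0 `]lft w, rgt w]%classic = (m w)%:E.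
Implicit Types (w v : seq bool).

Lemma ae_imply (P Q : R -> Prop) : (forall x, P x -> Q x) ->
  {ae mu0, forall x, P x} -> {ae mu0, forall x, Q x}.
Proof. by move=> PQ; apply: negligibleS => x nQ /PQ. Qed.

Lemma ae_both (P Q : R -> Prop) : {ae mu0, forall x, P x} ->
  {ae mu0, forall x, Q x} -> {ae mu0, forall x, P x /\ Q x}.
Proof.
move=> aP aQ; apply: negligibleS (negligibleU aP aQ) => x /= /not_andP[]; tauto.
Qed.

Section Unbounded.
Variables (W : seq bool -> R) (L : nat) (K : R).
Hypothesis escape : forall w, exists2 v, size v = L & K <= `|W (v ++ w)|.

(** Only every [L]-th ancestor is tested, so each block of [L] digits offers exactly one chance to
    escape. *)
Fixpoint stays_small j w :=
  if j is j'.+1 then (`|W w| < K) && stays_small j' (drop L w) else true.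

(** Whatever precedes it, the last block is an escaping one with conditional mass at least
    [eta ^+ L]; removing that block leaves the same statement with one test fewer. *)
Lemma stays_small_mass N j :
  \sum_(w <- words (j * L + N) | stays_small j w) m w <= (1 - eta ^+ L) ^+ j.
Proof.
have [m1 /andP[e0 e1] _ _] := mt.
elim: j => [|j IH].
  by under eq_bigr do rewrite -[X in m X]cats0; rewrite /= (mass_sum mt) m1 expr0.
have r0 : 0 <= 1 - eta ^+ L by rewrite subr_ge0 exprn_ile1 // ltW.
rewrite mulSn -addnA big_mkcond big_wordsD exprS.
apply: le_trans (ler_wpM2l r0 IH).
rewrite [X in _ <= _ * X]big_mkcond /= mulr_sumr; apply: ler_sum => w _.
rewrite [leLHS](_ : _ = if stays_small j w then
    \sum_(v <- words L) (if `|W (v ++ w)| < K then m (v ++ w) else 0) else 0); last first.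
  case: ifP => sw; [|apply: big1_seq => v /=]; [apply: eq_big_seq => v|];
    by rewrite mem_words => /eqP sv; rewrite drop_size_cat // sw ?andbT ?andbF.
case: ifP => _; last by rewrite mulr0.
have [v sv Kv] := escape w.
have vL : v \in words L by rewrite mem_words sv.
rewrite mulrBl mul1r -(mass_sum mt L w) (bigD1_seq v) ?uniq_words //=.
rewrite [X in _ <= X - _](bigD1_seq v) ?uniq_words //= ltNge Kv /= add0r.
have : \sum_(i <- words L | i != v) (if `|W (i ++ w)| < K then m (i ++ w) else 0)
    <= \sum_(i <- words L | i != v) m (i ++ w).
  by apply: ler_sum => i _; case: ifP => // _; apply: ltW (mass_gt0 mt _).
rewrite (mass_sum mt); have := mass_cat mt v w; rewrite sv; lra.
Qed.

Lemma stays_small_coding N j (x : R) :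
  (forall n, (N <= n)%N -> `|W (coding n x)| < K) ->
  stays_small j (coding (j * L + N) x).
Proof.
move=> h; elim: j => //= j IH; rewrite h; last by rewrite leq_addl.
by rewrite mulSn -addnA drop_coding.
Qed.

Lemma negligible_bounded N : mu0.-negligible
  [set x : R | 0 < x <= 1 /\ forall n, (N <= n)%N -> `|W (coding n x)| < K].
Proof.
have [m1 /andP[e0 e1] _ _] := mt.
apply: negligible_small => e egt0.
have [|j hj] := @geometric_lt R 1 (1 - eta ^+ L) e _ egt0.
  have : 0 < eta ^+ L by rewrite exprn_gt0.
  have : eta ^+ L <= 1 by rewrite exprn_ile1 // ltW.
  lra.
exists (coded (j * L + N) (stays_small j)); split.
- exact: (measurable_coded mu0_itv).
- by move=> x [x01 h]; split => //; exact: stays_small_coding.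
- rewrite (coded_measure mu0_itv) lee_fin; apply: le_trans (stays_small_mass N j) _.
  by rewrite -[leLHS]mul1r ltW.
Qed.

End Unbounded.

Lemma ae_unbounded W : martingale_on m W -> oscillating W ->
  {ae mu0, forall x : R, 0 < x <= 1 ->
     forall K N, exists2 n, (N <= n)%N & K <= `|W (coding n x)|}.
Proof.
move=> mW oW.
have key (k N : nat) : {ae mu0, forall x : R, 0 < x <= 1 ->
    exists2 n, (N <= n)%N & k%:R <= `|W (coding n x)|}.
  have [L hL] := oscillating_abs_ge mt k%:R mW oW.
  apply: negligibleS (negligible_bounded hL N) => x /= /not_implyP[x01 nex].
  split => // n Nn; rewrite ltNge; apply/negP => h; apply: nex.
  by exists n.
have : {ae mu0, forall x : R, forall k N : nat, 0 < x <= 1 ->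
    exists2 n, (N <= n)%N & k%:R <= `|W (coding n x)|}.
  apply: ae_foralln => k; apply: ae_foralln => N; exact: key.
apply: ae_imply => x h x01 K N.
have [n Nn hn] := h (Num.bound `|K|) N x01; exists n => //.
apply: le_trans hn; apply: le_trans (ler_norm _) _.
by rewrite ltW // archi_boundP.
Qed.

Lemma ae_mass_lower tau : mass_regime m tau ->
  {ae mu0, forall x : R, 0 < x <= 1 -> exists2 kappa, 0 < kappa &
     exists N, forall n, (N <= n)%N -> kappa * (tau / 2) ^+ n <= m (coding n x)}.
Proof.
case=> [[-> [kappa k0 lowm]]|[/andP[t1 t2] [theta th01 bad]]].
  apply: aeW => x x01; exists kappa => //; exists 0%N => n _.
  by rewrite mul1r -{1}(size_coding n x); exact: lowm.
have [C C0 hC] := bad [::].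
(* The masses of these sets are summable, so almost every point lies in finitely many of them;
   elsewhere [(tau ^+ 2 / 2) ^+ n] is at least [(tau / 2) ^+ n]. *)
pose B n : set R := coded n (fun w => m w < (tau ^+ 2 / 2) ^+ size w).
have B0 : mu0 (lim_sup_set B) = 0%E.
  apply: (borel_cantelli_geometric (C := C) (q := theta)) => // n.
    exact: (measurable_coded mu0_itv).
  rewrite (coded_measure mu0_itv) lee_fin; apply: le_trans (hC n).
  rewrite le_eqVlt; apply/orP; left; apply/eqP.
  by apply: eq_big => w; rewrite cats0.
have mB : measurable (lim_sup_set B : set (measurableTypeR R)).
  apply: bigcapT_measurable => n; apply: bigcup_measurable => k _.
  exact: (measurable_coded mu0_itv).
exists (lim_sup_set B); split => // x /= /not_implyP[x01 nex] N _.
apply: contrapT => nB; apply: nex; exists 1 => //; exists N => n Nn.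
rewrite mul1r leNgt; apply/negP => lt; apply: nB; exists n => //.
split => //; rewrite size_coding; apply: lt_le_trans lt _.
apply: lerXn2r; rewrite ?nnegrE ?divr_ge0 ?exprn_ge0 //; [lra..|].
by rewrite ler_wpM2r // expr2 ler_pMr; lra.
Qed.

End AlmostSureGrowth.

(** * Irregularity and singularity *)

Section Quotients.
Variables (R : realType) (f : R -> R) (c tau : R).
Hypotheses (c_ge0 : 0 <= c) (tau_gt0 : 0 < tau).
Hypothesis scale : forall n, (2^-1 ^+ n) `^ c = (tau / 2) ^+ n.

Lemma powR_le_scale (h : R) n : 0 <= h <= 2^-1 ^+ n -> h `^ c <= (tau / 2) ^+ n.
Proof.
move=> /andP[h0 hn]; rewrite -scale; apply: ge0_ler_powR; rewrite ?nnegrE //.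

Qed.

Lemma scale_gt0 n : 0 < (tau / 2) ^+ n.
Proof. by rewrite exprn_gt0 // divr_gt0. Qed.

Lemma limsup_quotient_pinfty x :
  (forall e K : R, 0 < e -> exists h, [/\ `|h| < e, h != 0, 0 <= x + h <= 1 &
     K <= `|f (x + h) - f x| / (`|h| `^ c)]) ->
  limsup_quotient f c x = +oo%E.
Proof.
move=> H; apply/eqP; rewrite -leye_eq; apply: le_ereal_inf_tmp => _ [V VF <-].
suff -> : ereal_sup [set (`|f (x + h) - f x| / (`|h| `^ c))%:E | h in V] = +oo%E by [].
have [e /= e0 He] : \forall h \near (0 : R)^', 0 <= x + h <= 1 -> V h by exact: VF.
apply/eqyP => K _; have [h [he hN0 h01 hK]] := H e K e0.
apply: (@le_trans _ _ ((`|f (x + h) - f x| / (`|h| `^ c))%:E)).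
  by rewrite lee_fin.
apply: ereal_sup_ubound; exists h => //.
by apply: He => //=; rewrite sub0r normrN.
Qed.

Lemma small_dyadic (e : R) : 0 < e -> exists n, 2^-1 ^+ n < e.
Proof.
move=> e0; have [|n hn] := @geometric_lt R 1 2^-1 e _ e0; first lra.
by exists n; rewrite -[ltLHS]mul1r.
Qed.

Lemma limsup_quotient_coding (m W : seq bool -> R) x kappa N0 :
  (forall w, f (rgt w) - f (lft w) = m w * W w) ->
  0 < x <= 1 -> 0 < kappa ->
  (forall n, (N0 <= n)%N -> kappa * (tau / 2) ^+ n <= m (coding n x)) ->
  (forall K N, exists2 n, (N <= n)%N & K <= `|W (coding n x)|) ->
  limsup_quotient f c x = +oo%E.
Proof.
move=> incr x01 k0 lowm unb; apply: limsup_quotient_pinfty => e K e0.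
have [N1 hN1] := small_dyadic e0.
pose K' := `|K| + 1.
have K'0 : 0 < K' by rewrite ltr_wpDl.
(* The factor 2 is spent when the increment is split between the two endpoints. *)
have [n] := unb (2 * K' / kappa) (maxn N0 N1); rewrite geq_max => /andP[n0 n1] hW.
have small : 2^-1 ^+ n < e :> R.
  by apply: le_lt_trans hN1; rewrite ler_wiXn2l //; lra.
have sn := scale_gt0 n.
set w := coding n x in hW.
have /andP[lx xr] := coding_itv n x01; rewrite -/w in lx xr.
have rl : rgt w = lft w + 2^-1 ^+ n :> R by rewrite /rgt size_coding.
have big : 2 * K' * (tau / 2) ^+ n <= `|f (rgt w) - f (lft w)|.
  rewrite incr normrM.
  apply: (@le_trans _ _ ((kappa * (tau / 2) ^+ n) * (2 * K' / kappa))).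
    by rewrite le_eqVlt; apply/orP; left; apply/eqP; field; rewrite gt_eqF.
  apply: ler_pM => //; first by rewrite mulr_ge0 // ltW.
    by rewrite divr_ge0 ?mulr_ge0 // ltW.
  by apply: le_trans (lowm n n0) (ler_norm _).
have tri : `|f (rgt w) - f (lft w)| <= `|f (rgt w) - f x| + `|f (lft w) - f x|.
  by rewrite (_ : _ - _ = (f (rgt w) - f x) - (f (lft w) - f x)) ?ler_normB //; ring.
have witness z : 0 <= z <= 1 -> `|z - x| <= 2^-1 ^+ n ->
    K' * (tau / 2) ^+ n <= `|f z - f x| ->
    exists h, [/\ `|h| < e, h != 0, 0 <= x + h <= 1 &
     K <= `|f (x + h) - f x| / (`|h| `^ c)].
  move=> z01 zx fz; exists (z - x); rewrite (_ : x + (z - x) = z); last by ring.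
  (* When [x] is itself an endpoint, the difference there is 0, so the lower bound on [|f z - f x|]
     rules that endpoint out. *)
  have zNx : z - x != 0.
    rewrite subr_eq0; apply/eqP => E; move: fz; rewrite E subrr normr0.
    by rewrite leNgt mulr_gt0.
  split => //; first exact: le_lt_trans zx small.
  have p0 : 0 < `|z - x| `^ c by apply: powR_gt0; rewrite normr_gt0.
  rewrite ler_pdivlMr //; apply: le_trans fz.
  apply: (@le_trans _ _ (K' * `|z - x| `^ c)).
    by rewrite ler_wpM2r ?(ltW p0) // /K' (le_trans (ler_norm _)) // lerDl.
  by rewrite ler_wpM2l ?(ltW K'0) // powR_le_scale // normr_ge0.
have h0 := halfX_gt0 R n.
have l0 := lft_ge0 R w; have r1 := rgt_le1 R w.
case: (leP (K' * (tau / 2) ^+ n) `|f (rgt w) - f x|) => h.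
  by apply: (witness (rgt w)) => //; [lra|rewrite ger0_norm; lra].
by apply: (witness (lft w)) => //; [lra|rewrite ltr0_norm; lra|lra].
Qed.

Lemma interval_contains_dyadic (J : set R) : open J -> J !=set0 ->
  J `<=` `[0, 1] ->
  exists w, forall v, J (lft (v ++ w)) /\ J (rgt (v ++ w)).
Proof.
move=> oJ [x Jx] J01.
have /nbhs_ballP[e /= e0 He] : nbhs x J by exact: open_nbhs_nbhs.
(* The point 0 lies in no cell; an open set inside [0, 1] cannot contain it. *)
have x01 : 0 < x <= 1.
  have := J01 x Jx; rewrite /= in_itv /= => /andP[_ ->]; rewrite andbT.
  have : J (x - e / 2).
    by apply: He; rewrite /ball /= (_ : x - _ = e / 2) ?ger0_norm; [lra|lra|ring].
  by move=> /J01; rewrite /= in_itv /= => /andP[h _]; lra.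
have [n hn] := small_dyadic e0.
exists (coding n x) => v.
have /andP[lx xr] := coding_itv n x01.
have [l1 l2] := lft_rgt_cat R v (coding n x).
have l3 := lft_lt_rgt R (v ++ coding n x).
have rl : rgt (coding n x) = lft (coding n x) + 2^-1 ^+ n :> R by rewrite /rgt size_coding.
by split; apply: He; rewrite /ball /= ltr_norml; lra.
Qed.

Lemma difference_quotients_large (J : set R) (K : R) : open J -> J !=set0 ->
  J `<=` `[0, 1] ->
  (forall w, exists v,
     K * (tau / 2) ^+ size (v ++ w) <= f (rgt (v ++ w)) - f (lft (v ++ w))) ->
  exists2 z, difference_quotients f c J z%:E & K <= z.
Proof.
move=> oJ Jn0 J01 large.
have [w Jw] := interval_contains_dyadic oJ Jn0 J01.
have [v hv] := large w; have [Jl Jr] := Jw v.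
exists ((f (rgt (v ++ w)) - f (lft (v ++ w))) / (rgt (v ++ w) - lft (v ++ w)) `^ c).
  by exists (rgt (v ++ w)), (lft (v ++ w)); split => //; exact: lft_lt_rgt.
have -> : rgt (v ++ w) - lft (v ++ w) = 2^-1 ^+ size (v ++ w) :> R.
  by rewrite /rgt addrAC subrr add0r.
by rewrite scale ler_pdivlMr ?scale_gt0.
Qed.

End Quotients.

Section Irregularity.
Variables (R : realType) (mu0 : probability (measurableTypeR R) R).
Variables (m : seq bool -> R) (eta : R).
Hypothesis mt : mass_tree m eta.
Hypothesis mu0_itv : forall w, mu0 `]lft w, rgt w]%classic = (m w)%:E.
Hypothesis mu0_0 : mu0 [set 0] = 0%E.
Variables (c tau : R).
Hypotheses (c_ge0 : 0 <= c) (tau_gt0 : 0 < tau).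
Hypothesis scale : forall n, (2^-1 ^+ n) `^ c = (tau / 2) ^+ n.
Hypothesis regime : mass_regime m tau.
Variables (f : R -> R) (W : seq bool -> R).
Hypothesis incr : forall w, f (rgt w) - f (lft w) = m w * W w.
Hypotheses (oW : oscillating W) (sW : subexponential W).

Lemma increments_martingale : martingale_on m W.
Proof.
move=> w; rewrite -!incr lft_true rgt_true lft_false.
by rewrite [RHS]addrC addrA subrK.
Qed.

Let mW := increments_martingale.

Lemma irregular_ae :
  {ae mu0, forall x : R, 0 <= x <= 1 -> limsup_quotient f c x = +oo%E}.
Proof.
have aN0 : {ae mu0, forall x : R, x != 0}.
  exists [set 0]; split => // x /= /negP; rewrite negbK => /eqP ->.
  by [].
have := ae_both aN0 (ae_both (ae_unbounded mt mu0_itv mW oW) (ae_mass_lower mu0_itv regime)).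
apply: ae_imply => x [xN0 [unb low]] /andP[x0 x1].
have x01 : 0 < x <= 1 by rewrite lt_def xN0 x0.
have [kappa k0 [N0 hN]] := low x01.
exact: (limsup_quotient_coding c_ge0 tau_gt0 scale incr x01 k0 hN (unb x01)).
Qed.

Lemma irregular_everywhere (J : set R) : open J -> J !=set0 -> J `<=` `[0, 1] ->
  ereal_sup (difference_quotients f c J) = +oo%E /\
  ereal_inf (difference_quotients f c J) = -oo%E.
Proof.
move=> oJ Jn0 J01; split.
  apply/eqyP => K _.
  have [|z Jz Kz] := difference_quotients_large tau_gt0 scale (K := K) (f := f) oJ Jn0 J01.
    move=> w; have [v hv] := mass_martingale_large mt w K regime mW oW sW.
    by exists v; rewrite incr.
  by apply: (@le_trans _ _ z%:E); [rewrite lee_fin|exact: ereal_sup_ubound].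
(* The infimum is treated as a supremum for [- f], whose increments are governed by the martingale
   [- W]. *)
suff below (K : R) : (ereal_inf (difference_quotients f c J) <= K%:E)%E.
  move: below; case: (ereal_inf _) => [r /(_ (r - 1))|/(_ 0)|] //.
  by rewrite lee_fin => h; exfalso; lra.
have [|z Jz Kz] := difference_quotients_large tau_gt0 scale (K := - K)
    (f := fun x => - f x) oJ Jn0 J01.
  move=> w; have [v hv] := mass_martingale_large mt w (- K) regime (martingale_onN mW)
    (oscillatingN oW) (subexponentialN sW).
  by exists v; move: hv; rewrite mulrN -incr; lra.
apply: (@le_trans _ _ (- z)%:E); last by rewrite lee_fin; lra.
apply: ereal_inf_lbound; case: Jz => x [y [Jx Jy yx [->]]].
exists x, y; split => //; congr EFin.
by rewrite -mulNr; congr (_ / _); ring.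
Qed.

End Irregularity.

(** * Deciding between singularity and absolute continuity *)

Section Singularity.
Variables (R : realType) (mu0 : probability (measurableTypeR R) R).
Variables (m : seq bool -> R) (eta : R).
Hypothesis mt : mass_tree m eta.
Hypothesis mu0_itv : forall w, mu0 `]lft w, rgt w]%classic = (m w)%:E.

Lemma ae_false : ~ {ae mu0, forall x : R, False}.
Proof.
move=> [A [mA A0 sub]].
have : (mu0 setT <= mu0 A)%E.
  by apply: le_measure; rewrite ?inE // => x _; apply: sub => /=; tauto.
by rewrite A0 probability_setT lee_fin ler10.
Qed.

Lemma ae_unit_interval : {ae mu0, forall x : R, 0 < x <= 1}.
Proof.
have [m1 _ _ _] := mt.
have mI : measurable (`]0, 1] : set (measurableTypeR R)) by exact: measurable_itv.
exists (~` `]0, 1]); split.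
- exact: measurableC.
- have := mu0_itv [::]; rewrite /rgt /= expr0 add0r m1 => e.
  by rewrite probability_setC // e subee.
- by move=> x /= h; rewrite in_itv.
Qed.

(** At most s^-n words of length n have mass at least s^n, and they cover Lebesgue measure at most
    (2s)^-n, which is summable for s > 1/2. For s < tau/2, mu_0-almost every point lies in all these
    sets from some level on. *)
Lemma regime_not_dominated tau : 1 < tau -> mass_regime m tau ->
  ~ (mu0 `<< @lebesgue_measure R).
Proof.
move=> t1 reg dom.
(* The midpoint of 1/2 and [tau / 2]. *)
pose s := (1 + tau) / 4.
have s0 : 0 < s by rewrite /s; lra.
have s2 : 1 < 2 * s by rewrite /s; lra.
have s2i : 0 <= (2 * s)^-1 < 1.
  by apply/andP; split; [rewrite invr_ge0; lra|rewrite invf_lt1 //; lra].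
pose Good n : set R := coded n (fun w => s ^+ size w <= m w).
have G0 : @lebesgue_measure R (lim_sup_set Good) = 0%E.
  apply: (borel_cantelli_geometric (C := 1) (q := (2 * s)^-1)) => //.
    by move=> n; exact: (measurable_coded mu0_itv).
  move=> n; rewrite (coded_measure (@lebesgue_dyadic R)) lee_fin mul1r.
  have [m1 _ _ _] := mt.
  apply: (@le_trans _ _ (\sum_(w <- words n) (2 * s)^-1 ^+ n * m w)); last first.
    rewrite -mulr_sumr; under eq_bigr do rewrite -[X in m X]cats0.
    by rewrite (mass_sum mt) m1 mulr1.
  have i0 : 0 <= (2 * s)^-1 ^+ n by rewrite exprn_ge0 //; case/andP: s2i.
  rewrite big_mkcond /= big_seq [leRHS]big_seq; apply: ler_sum => w.
  rewrite mem_words => /eqP sw; rewrite sw; case: ifP => [good|_]; last first.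
    by rewrite mulr_ge0 // ltW // (mass_gt0 mt).
  have -> : 2^-1 ^+ n = (2 * s)^-1 ^+ n * s ^+ n.
    by rewrite -exprMn invfM -mulrA mulVf ?mulr1 // gt_eqF.
  by rewrite ler_wpM2l.
have mG : measurable (lim_sup_set Good : set (measurableTypeR R)).
  apply: bigcapT_measurable => n; apply: bigcup_measurable => k _.
  exact: (measurable_coded mu0_itv).
have aG : {ae mu0, forall x : R, ~ lim_sup_set Good x}.
  exists (lim_sup_set Good); split => //.
    by move/null_content_dominatesP: dom; apply.
  by move=> x /=; rewrite notK.
have := ae_both (ae_both aG ae_unit_interval) (ae_mass_lower mu0_itv reg).
move=> h; apply: ae_false; move: h; apply: ae_imply => x [[nG x01] /(_ x01)].
move=> [kappa k0 [N hN]]; apply: nG => M _.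
have r0 : 0 < s / (tau / 2) by rewrite !divr_gt0 //; lra.
have r1 : s / (tau / 2) < 1 by rewrite ltr_pdivrMr /s; lra.
have [|n hn] := @geometric_lt R 1 (s / (tau / 2)) kappa _ k0.
  by rewrite r1 ltW.
pose n' := maxn n (maxn M N).
exists n'; first by rewrite /= /n' !leq_max leqnn orbT.
split => //; rewrite size_coding; apply: le_trans (hN n' _); last first.
  by rewrite /n' !leq_max leqnn !orbT.
have -> : s ^+ n' = (s / (tau / 2)) ^+ n' * (tau / 2) ^+ n'.
  by rewrite -exprMn divfK // gt_eqF //; lra.
rewrite ler_wpM2r ?exprn_ge0 //; first lra.
apply: (@le_trans _ _ ((s / (tau / 2)) ^+ n)); last by rewrite mul1r in hn; exact: ltW.
by apply: ler_wiXn2l; rewrite ?ltW // /n' leq_max leqnn.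
Qed.

(** On unions of cells mu_0 is at most [K] times Lebesgue measure. An open set of small measure
    around a Lebesgue-null set is exhausted, within (0, 1], by such unions, so the null set is also
    negligible for mu_0. *)
Lemma bounded_density_not_singular (K : R) : 0 <= K ->
  (forall w, m w <= K * 2^-1 ^+ size w) ->
  ~ mutually_singular mu0 (@lebesgue_measure R).
Proof.
move=> K0 mK [N [mN N1 N0]]; apply: ae_false.
have aN : {ae mu0, forall x : R, N x}.
  by exists (~` N); split => //; exact: measurableC.
suff aNN : {ae mu0, forall x : R, 0 < x <= 1 -> ~ N x}.
  by move: (ae_both (ae_both aN ae_unit_interval) aNN);
    apply: ae_imply => x [[Nx x01] /(_ x01)].
apply: negligible_small => e e0.
have e'0 : 0 < e / (K + 1) by rewrite divr_gt0 // ltr_wpDl.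
have [|U [oU NU lU]] := lebesgue_regularity_outer mN _ e'0.
  by rewrite (_ : _ N = 0%E) ?ltry //; exact: N0.
have {}lU : (@lebesgue_measure R U <= (e / (K + 1))%:E)%E.
  have mU : measurable U by exact: measurable_realfun.open_measurable.
  rewrite -(setDUK NU) (le_trans (measureU2 _ _ _)) //; first exact: measurableD.
  rewrite -[leRHS]add0e; apply: leeD; last exact: ltW.
  by rewrite le_eqVlt; apply/orP; left; apply/eqP; exact: N0.
pose V n : set (measurableTypeR R) :=
  coded n (fun w => `[< `]lft w, rgt w]%classic `<=` U >]).
have mV n : measurable (V n) by exact: (measurable_coded mu0_itv).
have VU n : V n `<=` U.
  by move=> x [x01 /asboolP]; apply; rewrite /= in_itv /=; exact: coding_itv.
have Vle n : (mu0 (V n) <= e%:E)%E.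
  apply: (@le_trans _ _ (K%:E * @lebesgue_measure R (V n))%E).
    rewrite (coded_measure mu0_itv) (coded_measure (@lebesgue_dyadic R)) -EFinM lee_fin.
    by rewrite mulr_sumr; apply: ler_sum.
  apply: (@le_trans _ _ (K%:E * (e / (K + 1))%:E)%E).
    apply: lee_wpmul2l; first by rewrite lee_fin.
    apply: le_trans lU; apply: le_measure; rewrite ?inE //.
    exact: measurable_realfun.open_measurable.
  by rewrite -EFinM lee_fin mulrCA ger_pMr // ler_pdivrMr ?mul1r ?lerDl // ltr_wpDl.
exists (\bigcup_n V n); split.
- exact: bigcupT_measurable.
- move=> x /= /not_implyP[x01 /contrapT Nx].
  have /nbhs_ballP[r /= r0 Hr] : nbhs x U by apply: open_nbhs_nbhs; split => //; exact: NU.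
  have [n hn] := small_dyadic r0.
  exists n => //; split => //; apply/asboolP => z; rewrite /= in_itv /= => /andP[lz zr].
  have /andP[lx xr] := coding_itv n x01.
  apply: Hr; have rl : rgt (coding n x) = lft (coding n x) + 2^-1 ^+ n :> R.
    by rewrite /rgt size_coding.
  by rewrite /ball /= ltr_norml; lra.
- have nd : nondecreasing_seq V.
    apply/nondecreasing_seqP => n; apply/subsetPset => x [x01 /asboolP h].
    split => //; apply/asboolP => z; rewrite /= in_itv /= => /andP[lz zr].
    apply: h; rewrite /= in_itv /=.
    have [l1 l2] := lft_rgt_cat R [:: rgt (false :: coding n x) < x] (coding n x).
    by rewrite (le_lt_trans l1 lz) (le_trans zr l2).
  have cv := @nondecreasing_cvg_mu _ _ _ mu0 V mV (bigcupT_measurable _ mV) nd.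
  rewrite -(cvg_lim _ cv) //; apply: lime_le; first by apply/cvg_ex; eexists; exact: cv.
  by apply: nearW => n; exact: Vle.
Qed.

End Singularity.

(** * The two regimes for de Rham masses *)

Section Regimes.
Variables (R : realType) (b u v : R).
Hypothesis adm : admissible b u v.
Implicit Types (w : seq bool) (y : R).

Let al := alpha b u v.
Let be := beta b u v.
Local Notation G := (Gdigit b u v).
Local Notation H := (Hdigit b).
Local Notation orb := (node b u v).
Local Notation ma := (mass b u v).

(** * Parameters with a Moebius distribution function *)

Section AbsolutelyContinuous.
Hypotheses (hu : u = 1 / (2 * b) - 1) (hv : v = 1 - 2 * b).

Let q := b / (1 - b).
Let D (x : R) := (q - 1) * x + 1.

(** The masses are the increments of x -> q x / D(x), the Moebius map that fixes 0 and 1 and takes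
    the value b at 1/2. *)
Lemma ac_closed_form w : 1 + orb w = D (rgt w) / (q * D (lft w)) /\
  ma w = 2^-1 ^+ size w * q / (D (lft w) * D (rgt w)).
Proof.
have [/andP[b0 b1] _ _ _ _] := admissible_mul adm.
have q0 : 0 < q by rewrite divr_gt0 //; lra.
have D0 (x : R) : 0 <= x <= 1 -> 0 < D x.
  move=> /andP[x0 x1]; rewrite /D.
  have [->|xN1] := eqVneq x 1; first lra.
  have : 0 < 1 - x by rewrite subr_gt0 lt_def eq_sym xN1.
  have : 0 <= q * x by rewrite mulr_ge0 // ltW.
  lra.
have qE : q * (1 - b) = b by rewrite divfK // gt_eqF //; lra.
elim: w => [|i w [IHo IHm]].
  rewrite /rgt /= expr0 add0r mul1r /D mulr0 mulr1 add0r addr0 subrK mul1r mulr1.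
  by rewrite divff ?divr1 ?divff // gt_eqF.
have [l1 l2] := lft_rgt_cat R [:: i] w; have l0 := lft_ge0 R w.
have r1 := rgt_le1 R w; have lr := lft_lt_rgt R w.
have lr' := lft_lt_rgt R (i :: w).
have Dl : 0 < D (lft w) by apply: D0; lra.
have Dr : 0 < D (rgt w) by apply: D0; lra.
have Dm : 0 < D (rgt (false :: w)).
  apply: D0; have := halfX_gt0 R (size w).+1; have := halfXS R (size w).
  by move: r1; rewrite /rgt /=; lra.
have Dmid : D (rgt (false :: w)) = (D (lft w) + D (rgt w)) / 2.
  by rewrite /D /rgt /= exprS; field.
have orbE : orb w = D (rgt w) / (q * D (lft w)) - 1 by rewrite -IHo; ring.
have den := node_den_gt0 adm w.
have dd : 0 < D (lft w) + D (rgt w) by lra.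
have bE : b * node b u v w + 1 = (1 - b) * (D (lft w) + D (rgt w)) / D (lft w).
  rewrite orbE /q; field; rewrite !gt_eqF //; lra.
rewrite /= IHm.
case: i {l1 l2 lr'} => /=; rewrite -?/(lft (true :: w)) -?/(lft (false :: w)).
  rewrite lft_true rgt_true Dmid bE orbE hv /q exprS.
  by split; field; rewrite !gt_eqF //; lra.
rewrite lft_false Dmid bE orbE hu /q exprS.
by split; field; rewrite !gt_eqF //; lra.
Qed.

Lemma ac_mass_bounds : exists kappa K, [/\ 0 < kappa, 0 <= K &
  forall w, kappa * 2^-1 ^+ size w <= ma w <= K * 2^-1 ^+ size w].
Proof.
have [/andP[b0 b1] _ _ _ _] := admissible_mul adm.
have q0 : 0 < q by rewrite divr_gt0 //; lra.
pose a0 := Num.min 1 q; pose a1 := Num.max 1 q.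
have a00 : 0 < a0 by rewrite lt_min ltr01 q0.
have [h1 h2] : a0 <= 1 /\ a0 <= q by rewrite !ge_min !lexx orbT.
have [h3 h4] : 1 <= a1 /\ q <= a1 by rewrite !le_max !lexx orbT.
(* [D] is affine with end values 1 and [q]. *)
have Db (x : R) : 0 <= x <= 1 -> a0 <= D x <= a1.
  move=> /andP[x0 x1]; rewrite /D.
  have x'0 : 0 <= 1 - x by lra.
  have := ler_wpM2l x0 h2; have := ler_wpM2l x'0 h1.
  have := ler_wpM2l x0 h4; have := ler_wpM2l x'0 h3.
  by move=> *; apply/andP; split; lra.
have a10 : 0 < a1 by lra.
exists (q / a1 ^+ 2), (q / a0 ^+ 2); split.
- by rewrite divr_gt0 // exprn_gt0.
- by rewrite divr_ge0 ?exprn_ge0 // ltW.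
move=> w; have [_ ->] := ac_closed_form w.
have l0 := lft_ge0 R w; have r1 := rgt_le1 R w; have lr := lft_lt_rgt R w.
have /andP[x1 x2] : a0 <= D (lft w) <= a1 by apply: Db; lra.
have /andP[y1 y2] : a0 <= D (rgt w) <= a1 by apply: Db; lra.
have p1 : 0 < D (lft w) by lra.
have p2 : 0 < D (rgt w) by lra.
have p3 : 0 < D (lft w) * D (rgt w) by rewrite mulr_gt0.
have t0 : 0 < 2^-1 ^+ size w * q by rewrite mulr_gt0 // halfX_gt0.
have e (z : R) : q / z * 2^-1 ^+ size w = 2^-1 ^+ size w * q / z.
  by rewrite mulrAC [q * _]mulrC.
rewrite !e.
rewrite !(ler_pM2l t0) !lef_pV2 ?posrE ?exprn_gt0 // !expr2.
by apply/andP; split; apply: ler_pM => //; lra.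
Qed.

End AbsolutelyContinuous.

(** * Exponential gain from unfair digits *)

Section Singular.
Hypothesis not_ac : ~ (u = 1 / (2 * b) - 1 /\ v = 1 - 2 * b).

Lemma sqrt_sum_le (x y : R) : 0 <= x -> 0 <= y -> x + y = 1 ->
  Num.sqrt x + Num.sqrt y <= Num.sqrt 2 ?= iff (x == y).
Proof.
move=> x0 y0 xy.
have sx := sqr_sqrtr x0; have sy := sqr_sqrtr y0.
have s2 : Num.sqrt (2 : R) ^+ 2 = 2 by rewrite sqr_sqrtr.
have E : (Num.sqrt x + Num.sqrt y) ^+ 2 = 2 - (Num.sqrt x - Num.sqrt y) ^+ 2.
  by rewrite sqrrD sqrrB sx sy -xy; ring.
have sum0 : 0 <= Num.sqrt x + Num.sqrt y by rewrite addr_ge0 ?sqrtr_ge0.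
split.
  rewrite -(ler_pXn2r (ltn0Sn 1)) ?nnegrE ?sqrtr_ge0 // s2 E gerBl.
  exact: sqr_ge0.
rewrite -(eqrXn2 (ltn0Sn 1) sum0 (sqrtr_ge0 _)) s2 E.
rewrite -subr_eq0 addrAC subrr add0r oppr_eq0 sqrf_eq0 subr_eq0.
by rewrite eqr_sqrt.
Qed.

Let S2 y := Num.sqrt (H false y) * (Num.sqrt (H false (G false y)) + Num.sqrt (H true (G false y)))
  + Num.sqrt (H true y) * (Num.sqrt (H false (G true y)) + Num.sqrt (H true (G true y))).

Lemma Hdigit_gt0 i y : al <= y -> 0 < H i y.
Proof.
have [/andP[b0 b1] _ _ _ _] := admissible_mul adm.
have [a1 _ _ _ _] := alpha_beta_bounds adm.
move=> ay; have := den_gt0 adm ay; have : al <= y by [].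
rewrite -/al => *; rewrite /Hdigit; case: i; rewrite divr_gt0 //; first lra.
rewrite mulr_gt0 //; move: a1; rewrite -/al; lra.
Qed.

(** A digit is fair only at the node [(1 - 2 * b) / b]. The value 2 would force [y] and both its
    images to equal that node, making it a common fixed point, which occurs only for the excluded
    parameters. Two digits are grouped because a single one may well be fair. *)
Lemma S2_lt2 y : al <= y <= be -> S2 y < 2.
Proof.
move=> yab; have /andP[ay yb] := yab.
have [/andP[b0 b1] u1 u2 v1 v2] := admissible_mul adm.
have s2 : Num.sqrt (2 : R) * Num.sqrt 2 = 2 by rewrite -expr2 sqr_sqrtr.
have s0 : 0 < Num.sqrt (2 : R) by rewrite sqrtr_gt0.
have st z : al <= z -> Num.sqrt (H false z) + Num.sqrt (H true z) <= Num.sqrt 2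
    ?= iff (H false z == H true z).
  move=> az; apply: sqrt_sum_le; rewrite ?(ltW (Hdigit_gt0 _ az)) //.
  exact: Hdigit_sum adm _ az.
have eqH z : al <= z -> (H false z == H true z) -> z = (1 - 2 * b) / b.
  move=> az; have d := den_gt0 adm az; rewrite /Hdigit.
  have dN : b * z + 1 != 0 by rewrite gt_eqF.
  rewrite (inj_eq (mulIf _)) ?invr_eq0 // => /eqP E.
  apply: (mulfI (_ : b != 0)); first by rewrite gt_eqF.
  by rewrite mulrCA divff ?gt_eqF // mulr1; lra.
have aG i : al <= G i y by have /andP[] := Gdigit_in adm i yab.
have p0 : 0 < Num.sqrt (H false y) by rewrite sqrtr_gt0; exact: Hdigit_gt0.
have p1 : 0 < Num.sqrt (H true y) by rewrite sqrtr_gt0; exact: Hdigit_gt0.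
have [le0 eq0] := st _ ay.
have [le1 eq1] := st _ (aG false).
have [le2 eq2] := st _ (aG true).
rewrite ltNge; apply/negP => ge2.
have m1 := ler_wpM2l (ltW p0) le1; have m2 := ler_wpM2l (ltW p1) le2.
have m0 := ler_wpM2r (ltW s0) le0.
have e0 : Num.sqrt (H false y) + Num.sqrt (H true y) = Num.sqrt 2.
  apply/eqP; rewrite eq_le le0 /= -(ler_pM2r s0) s2.
  by move: ge2; rewrite /S2; lra.
have e1 : Num.sqrt (H false (G false y)) + Num.sqrt (H true (G false y)) = Num.sqrt 2.
  apply/eqP; rewrite eq_le le1 /= -(ler_pM2l p0).
  by move: ge2; rewrite /S2; lra.
have e2 : Num.sqrt (H false (G true y)) + Num.sqrt (H true (G true y)) = Num.sqrt 2.
  apply/eqP; rewrite eq_le le2 /= -(ler_pM2l p1).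
  by move: ge2; rewrite /S2; lra.
move: eq0 eq1 eq2; rewrite e0 e1 e2 eqxx => /esym/(eqH _ ay) y0.
move=> /esym/(eqH _ (aG false)) g0 /esym/(eqH _ (aG true)) g1.
apply: not_ac; split.
  move: g0; rewrite /= y0 => E.
  apply: (mulfI (_ : (2 * (1 - b)) != 0)); first by rewrite gt_eqF //; lra.
  have : (1 + u) * (1 - 2 * b) + u = (1 - 2 * b) / b.
    by rewrite -[RHS]E; field; rewrite gt_eqF.
  move=> {}E; have : 2 * (1 - b) * u = (1 - 2 * b) / b - (1 - 2 * b) by rewrite -E; ring.
  by move=> ->; field; rewrite gt_eqF.
move: g1; rewrite /= y0 => E.
have d : 0 < 2 * (1 - b) by lra.
have {}E : ((1 - b + v) * ((1 - 2 * b) / b) + v) = (1 - 2 * b) / b * (2 * (1 - b)).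
  rewrite -[in RHS]E; field; rewrite !gt_eqF //; lra.
apply: (mulfI (_ : (1 - b) != 0)); first by rewrite gt_eqF //; lra.
have kE : b * ((1 - 2 * b) / b) = 1 - 2 * b by rewrite mulrC divfK // gt_eqF.
move: ((1 - 2 * b) / b) kE E => k kE E.
have : (1 - b + v) * (b * k) + b * v = (b * k) * (2 * (1 - b)).
  have -> : (1 - b + v) * (b * k) + b * v = b * ((1 - b + v) * k + v) by ring.
  by rewrite E; ring.
by rewrite kE; lra.
Qed.

Lemma Hdigit_cont i y : al <= y -> {for y, continuous (H i)}.
Proof.
move=> ay; have d := den_gt0 adm ay.
have cd : {for y, continuous (fun z => (b * z + 1)^-1)}.
  by apply: cvgV; [rewrite gt_eqF|apply: cvgD; [apply: cvgMr; exact: cvg_id|exact: cvg_cst]].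
case: i; apply: cvgM => //; first exact: cvg_cst.
by apply: cvgMr; apply: cvgD; [exact: cvg_cst|exact: cvg_id].
Qed.

Lemma Gdigit_cont i y : al <= y -> {for y, continuous (G i)}.
Proof.
move=> ay; have d := den_gt0 adm ay.
case: i; last first.
  by apply: cvgD; [apply: cvgMr; exact: cvg_id|exact: cvg_cst].
apply: cvgM.
  by apply: cvgD; [apply: cvgMr; exact: cvg_id|exact: cvg_cst].
by apply: cvgV; [rewrite gt_eqF|apply: cvgD; [apply: cvgMr; exact: cvg_id|exact: cvg_cst]].
Qed.

Lemma S2_max : exists2 t, 1 <= t < 2 & forall y, al <= y <= be -> S2 y <= t.
Proof.
have [_ a0 be0 _ _] := alpha_beta_bounds adm.
have [|y yab ymax] := @EVT_max R S2 al be (le_trans a0 be0).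
  apply: continuous_in_subspaceT => y; rewrite inE /= in_itv /= => yab.
  have /andP[ay _] := yab.
  have cS (g : R -> R) : {for y, continuous g} ->
      {for y, continuous (fun z => Num.sqrt (g z))}.
    by move=> cg; apply: (continuous_comp cg); exact: sqrt_continuous.
  have cHG i j : {for y, continuous (fun z => H j (G i z))}.
    apply: (@continuous_comp _ _ _ (G i) (H j) y); first exact: Gdigit_cont.
    by apply: Hdigit_cont; have /andP[] := Gdigit_in adm i yab.
  by apply: cvgD; apply: cvgM; rewrite ?/(continuous_at _ _);
    try (apply: cvgD); apply: cS => //; exact: Hdigit_cont.
(* The maximum with 1 keeps the resulting growth rate [s] at least 1, which later gives
   [q / s < 2]. *)
exists (Num.max 1 (S2 y)).
  rewrite le_max lexx /= gt_max S2_lt2 ?andbT //; lra.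
by move=> z zab; rewrite le_max ymax ?orbT.
Qed.

Lemma sum_sqrt_mass_le : exists2 s, 1 <= s < Num.sqrt 2 &
  forall w, exists2 C, 0 <= C &
    forall n, \sum_(x <- words n) Num.sqrt (ma (x ++ w)) <= C * s ^+ n.
Proof.
have [t /andP[t1 t2] St] := S2_max.
have [eta mt] := mass_mass_tree adm.
have mge0 w : 0 <= ma w by apply: ltW (mass_gt0 mt w).
exists (Num.sqrt t).
  by rewrite -{1}[1]sqrtr1 ler_sqrt ?ltr_sqrt ?t1 //; lra.
move=> w; pose Sn n := \sum_(x <- words n) Num.sqrt (ma (x ++ w)).
have Sn0 n : 0 <= Sn n by apply: sumr_ge0 => x _; exact: sqrtr_ge0.
have step n : Sn n.+2 <= t * Sn n.
  rewrite /Sn -[n.+2]/(2 + n)%N big_wordsD mulr_sumr; apply: ler_sum => x _.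
  have sumS k (F : seq bool -> R) : \sum_(z <- words k.+1) F z =
      \sum_(z <- words k) (F (false :: z) + F (true :: z)) by rewrite big_wordsS.
  rewrite !sumS big_words0 !cat_cons cat0s.
  have massE i z : ma (i :: z) = ma z * H i (node b u v z) by [].
  have nodeE i z : node b u v (i :: z) = G i (node b u v z) by [].
  rewrite !massE !nodeE; set y := node b u v (x ++ w).
  have yab : al <= y <= be by exact: node_in.
  have ay : al <= y by case/andP: yab.
  have hH i : 0 <= H i y by exact: ltW (Hdigit_gt0 _ ay).
  have sq3 (p r q : R) : 0 <= p -> 0 <= r ->
      Num.sqrt (p * r * q) = Num.sqrt p * (Num.sqrt r * Num.sqrt q).
    by move=> p0 r0; rewrite -mulrA !sqrtrM.
  rewrite !(sq3 _ _ _ (mge0 _) (hH _)) [t * _]mulrC.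
  rewrite -!mulrDr; apply: ler_wpM2l; first exact: sqrtr_ge0.
  by apply: le_trans (St _ yab); rewrite /S2; lra.
have s1 : 1 <= Num.sqrt t by rewrite -[1]sqrtr1 ler_sqrt //; lra.
exists (Sn 0%N + Sn 1%N); first exact: addr_ge0.
move=> n; rewrite -/(Sn n).
(* The recursion advances by two levels, so two consecutive levels are carried through the
   induction. *)
suff [] : Sn n <= (Sn 0%N + Sn 1%N) * Num.sqrt t ^+ n /\
     Sn n.+1 <= (Sn 0%N + Sn 1%N) * Num.sqrt t ^+ n.+1 by [].
elim: n => [|n [IH1 IH2]].
  rewrite expr0 expr1 mulr1; split; first by rewrite lerDl.
  apply: (@le_trans _ _ (Sn 0%N + Sn 1%N)); first by rewrite lerDr.
  by rewrite ler_peMr // addr_ge0.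
split => //; apply: le_trans (step n) _.
have -> : (Sn 0%N + Sn 1%N) * Num.sqrt t ^+ n.+2 = t * ((Sn 0%N + Sn 1%N) * Num.sqrt t ^+ n).
  have tt : t = Num.sqrt t * Num.sqrt t by rewrite -expr2 sqr_sqrtr //; lra.
  rewrite !exprS; move: (Sn 0%N + Sn 1%N) (Num.sqrt t) tt => x r ->.
  by move: (r ^+ n) => z; ring.
by rewrite ler_wpM2l //; lra.
Qed.

(** A Chebyshev bound: if m < (tau^2 / 2)^n, then m <= (tau / sqrt 2)^n sqrt m, and the sum of sqrt
    m is O(s^n). So the light words weigh O((tau s / sqrt 2)^n). *)
Lemma singular_regime : exists2 tau, 1 < tau < 2 & mass_regime ma tau.
Proof.
have [s /andP[s1 s2] hs] := sum_sqrt_mass_le.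
have [eta mt] := mass_mass_tree adm.
pose q := Num.sqrt (2 : R).
have q0 : 0 < q by rewrite sqrtr_gt0.
have qq : q ^+ 2 = 2 by rewrite sqr_sqrtr.
have q2 : q < 2 by nra.
have s0 : 0 < s by lra.
have r1 : 1 < q / s by rewrite ltr_pdivlMr // mul1r.
have r2 : q / s < 2.
  by rewrite ltr_pdivrMr //; apply: lt_le_trans q2 _; rewrite ler_pMr.
(* The midpoint of 1 and [q / s], so that [theta = tau * s / q] is below 1. *)
pose tau := (1 + q / s) / 2.
have t12 : 1 < tau < 2 by rewrite /tau; lra.
have t0 : 0 < tau by lra.
exists tau => //; right; split => //.
have th : tau * s / q = (s / q + 1) / 2 by rewrite /tau; field; rewrite !gt_eqF.
have sq1 : s / q < 1 by rewrite ltr_pdivrMr // mul1r.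
have sq0 : 0 < s / q by rewrite divr_gt0.
exists (tau * s / q); first by rewrite th; lra.
move=> w; have [C C0 hC] := hs w.
exists ((tau / q) ^+ size w * C); first by rewrite mulr_ge0 // exprn_ge0 // divr_ge0 // ltW.
move=> n.
apply: (@le_trans _ _ (\sum_(x <- words n)
    (tau / q) ^+ (n + size w) * Num.sqrt (ma (x ++ w)))).
  rewrite big_mkcond big_seq [leRHS]big_seq; apply: ler_sum => x.
  rewrite mem_words => /eqP sx; rewrite size_cat sx.
  have p0 : 0 <= (tau / q) ^+ (n + size w) by rewrite exprn_ge0 // divr_ge0 // ltW.
  case: ifP => [bad|_]; last by rewrite mulr_ge0 // sqrtr_ge0.
  have m0 := mass_gt0 mt (x ++ w).
  rewrite -{1}(sqr_sqrtr (ltW m0)) expr2 ler_wpM2r ?sqrtr_ge0 //.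
  rewrite -(ler_pXn2r (ltn0Sn 1)) ?nnegrE ?sqrtr_ge0 //.
  rewrite sqr_sqrtr ?(ltW m0) // exprAC expr_div_n qq; exact: ltW.
rewrite -mulr_sumr.
apply: le_trans (ler_wpM2l _ (hC n)) _; first by rewrite exprn_ge0 // divr_ge0 // ltW.
have -> : tau * s / q = (tau / q) * s by rewrite mulrAC.
rewrite exprD [(tau / q * s) ^+ n]exprMn le_eqVlt; apply/orP; left; apply/eqP.
by move: ((tau / q) ^+ n) ((tau / q) ^+ size w) (s ^+ n) => x1 x2 x3; ring.
Qed.

End Singular.
End Regimes.

(** * Derivative of the masses along a curve *)

Lemma subexponential_increments (R : realType) (U V : seq bool -> R) (C : R) :
  0 <= C -> (forall i w, `|U (i :: w) - U w| <= C * `|V w|) ->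
  subexponential V -> subexponential U.
Proof.
move=> C0 step sV lam lam1; have [B B0 hB] := sV lam lam1.
have l0 : 0 < lam - 1 by lra.
(* With [C * B <= D * (lam - 1)] the induction closes at the same rate [lam]. *)
pose D := C * B / (lam - 1) + `|U [::]|.
have CB : 0 <= C * B / (lam - 1) by rewrite divr_ge0 ?mulr_ge0 // ltW.
have D0 : 0 <= D by rewrite addr_ge0.
exists D => //; elim=> [|i w IH]; first by rewrite expr0 mulr1 lerDr.
have ln0 : 0 <= lam ^+ size w by rewrite exprn_ge0 //; lra.
have h1 : `|U (i :: w)| <= `|U (i :: w) - U w| + `|U w|.
  by rewrite -{1}[U (i :: w)](subrK (U w)) ler_normD.
have h2 : `|U (i :: w) - U w| <= C * (B * lam ^+ size w).
  by apply: le_trans (step i w) _; rewrite ler_wpM2l.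
have h3 : C * B <= D * (lam - 1).
  by rewrite mulrDl divfK ?gt_eqF // lerDl mulr_ge0 // ltW.
have h4 := ler_wpM2r ln0 h3.
rewrite [size _]/= exprS; move: (lam ^+ size w) {ln0} IH h2 h4 => z; lra.
Qed.

Lemma oscillating_neq_step (R : realType) (U : seq bool -> R) (d : R) :
  0 < d -> (forall w, d <= `|U (false :: w) - U w|) -> oscillating U.
Proof.
move=> d0 h; exists 1%N, d; split => // w; exists [:: false] => //; exact: h.
Qed.

Section RealDerivatives.
Variables (R : realType) (f g : R -> R) (x df dg : R).
Hypotheses (hf : is_derive x (1 : R) f df) (hg : is_derive x (1 : R) g dg).

Lemma is_derive_add : is_derive x (1 : R) (fun t => f t + g t) (df + dg).
Proof. exact: is_deriveD. Qed.

Lemma is_derive_mul : is_derive x (1 : R) (fun t => f t * g t) (df * g x + f x * dg).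
Proof.
by apply: is_derive_eq (is_deriveM hf hg) _; rewrite /GRing.scale /= addrC [g x * _]mulrC.
Qed.

Lemma is_derive_opp : is_derive x (1 : R) (fun t => - f t) (- df).
Proof. exact: is_deriveN. Qed.

Lemma is_derive_div : g x != 0 ->
  is_derive x (1 : R) (fun t => f t / g t) (df / g x - f x * dg / g x ^+ 2).
Proof.
move=> gx0.
have hV : is_derive x (1 : R) (fun t => (g t)^-1) (- dg / g x ^+ 2).
  apply: DeriveDef; first by apply: derivableV => //; case: hg.
  have [gd gE] := hg.
  by rewrite deriveV // gE /GRing.scale /= mulrC mulrN mulNr.
apply: is_derive_eq (is_deriveM hf hV) _.
by rewrite /GRing.scale /=; field.
Qed.

Lemma derive1_is_derive : derive1 f x = df.
Proof. by rewrite derive1E derive_val. Qed.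

End RealDerivatives.

Section Variation.
Variables (R : realType) (b u v db du dv : R).
Implicit Types (w : seq bool) (y : R).

Definition Gdigit_dt (i : bool) y : R :=
  if i then ((dv - db) * y + dv) / (b * y + 1)
            - ((1 - b + v) * y + v) * (db * y) / (b * y + 1) ^+ 2
  else (db * (1 + u) + b * du) * y + du.

Definition Gdigit_dy (i : bool) y : R :=
  if i then (1 - b) * (1 + v) / (b * y + 1) ^+ 2 else b * (1 + u).

Fixpoint dnode w : R :=
  if w is i :: w' then
    Gdigit_dt i (node b u v w') + Gdigit_dy i (node b u v w') * dnode w'
  else 0.

(** The derivative of [Hdigit false] when the node [y] moves with speed [dy]; that of [Hdigit true]
    is its opposite, as the two sum to 1. *)
Definition Hdigit_der y dy : R :=
  (db * (1 + y) + b * (1 - b) * dy) / (b * y + 1) ^+ 2.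

(* The logarithmic derivative of [mass] in the direction [(db, du, dv)]. *)
Fixpoint logder w : R :=
  if w is i :: w' then
    logder w' + (-1) ^+ i * Hdigit_der (node b u v w') (dnode w')
                / Hdigit b i (node b u v w')
  else 0.

Hypothesis adm : admissible b u v.
Let al := alpha b u v.
Let be := beta b u v.

Hypothesis contracting : forall y, al <= y <= be -> Gdigit_dy true y < 1.

Lemma Gdigit_dy_ge0 i y : al <= y -> 0 <= Gdigit_dy i y.
Proof.
have [/andP[b0 b1] u1 u2 v1 v2] := admissible_mul adm.
move=> ay; have d := den_gt0 adm ay.
by case: i; rewrite /= ?divr_ge0 ?mulr_ge0 ?exprn_ge0 //; lra.
Qed.

Lemma Gdigit_dy_bound : exists2 r, 0 <= r < 1 &
  forall i y, al <= y <= be -> Gdigit_dy i y <= r.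
Proof.
have [/andP[b0 b1] u1 u2 v1 v2] := admissible_mul adm.
have [_ a0 be0 _ _] := alpha_beta_bounds adm.
have alal : al <= al <= be by rewrite lexx /= (le_trans a0).
have r1 := contracting alal.
have r0 := Gdigit_dy_ge0 true (lexx al).
(* The derivative of G_1 in y decreases with y, hence is largest at [al]. *)
exists (Num.max (Gdigit_dy true al) (b * (1 + u))).
  by rewrite le_max r0 /= gt_max r1 u2.
move=> i y /andP[ay yb]; rewrite le_max; apply/orP; case: i; [left|by right].
have d0 := den_gt0 adm (lexx al); have d1 := den_gt0 adm ay.
rewrite /= ler_wpM2l //; first by rewrite mulr_ge0 //; lra.
rewrite lef_pV2 ?posrE ?exprn_gt0 //; apply: lerXn2r; rewrite ?nnegrE.
- exact: ltW.
- exact: ltW.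
- by rewrite lerD2r ler_pM2l.
Qed.

Lemma Gdigit_dt_bound : exists C, forall i y, al <= y <= be -> `|Gdigit_dt i y| <= C.
Proof.
have [_ a0 be0 _ _] := alpha_beta_bounds adm.
have bnd i : exists C, forall y, al <= y <= be -> `|Gdigit_dt i y| <= C.
  have [|y yab ymax] := @EVT_max R (fun y => `|Gdigit_dt i y|) al be (le_trans a0 be0).
    apply: continuous_in_subspaceT => y; rewrite inE /= in_itv /= => /andP[ay _].
    have d := den_gt0 adm ay.
    apply: (@continuous_comp _ _ _ (Gdigit_dt i) (fun z : R => `|z|) y); last exact: norm_continuous.
    have caff (p q : R) : (p * z + q) @[z --> y] --> p * y + q.
      by apply: cvgD; [apply: cvgMr; exact: cvg_id|exact: cvg_cst].
    case: i => /=; last exact: caff.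
    apply: cvgB.
      by apply: cvgM; [exact: caff|apply: cvgV; [rewrite gt_eqF|exact: caff]].
    apply: cvgM.
      by apply: cvgM; [exact: caff|apply: cvgMr; exact: cvg_id].
    apply: cvgV; first by rewrite expf_neq0 // gt_eqF.
    by apply: cvgM; exact: caff.
  by exists `|Gdigit_dt i y| => z zab; exact: ymax.
have [C0 h0] := bnd false; have [C1 h1] := bnd true.
by exists (Num.max C0 C1) => -[] y yab; rewrite le_max ?h0 ?h1 ?orbT.
Qed.

Lemma dnode_bound : exists M, forall w, `|dnode w| <= M.
Proof.
have [C hC] := Gdigit_dt_bound; have [r /andP[r0 r1] hr] := Gdigit_dy_bound.
have C0 : 0 <= C.
  have [_ a0 be0 _ _] := alpha_beta_bounds adm.
  by apply: le_trans (hC true al _); rewrite // lexx /= (le_trans a0).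
have M0 : 0 <= C / (1 - r) by rewrite divr_ge0 //; lra.
exists (C / (1 - r)); elim=> [|i w IH]; first by rewrite normr0.
have nab : al <= node b u v w <= be by exact: node_in.
rewrite [dnode _]/=; apply: le_trans (ler_normD _ _) _.
have e : C / (1 - r) = C + r * (C / (1 - r)) by field; rewrite gt_eqF //; lra.
rewrite e; apply: lerD; first exact: hC.
rewrite normrM; apply: ler_pM => //.
by rewrite ger0_norm ?hr //; apply: Gdigit_dy_ge0; case/andP: nab.
Qed.

Variable m : R.
Hypothesis m_le0 : m <= 0.
Hypothesis m_delta : forall i y, al <= y <= be -> m * (1 - Gdigit_dy i y) <= Gdigit_dt i y.
Hypothesis nondegenerate : 0 < db * (al + 1) + b * (1 - b) * m.

(** The half-line above [m] is invariant: [m_delta] says exactly that a node moving with speed [m]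
    has an image moving at least that fast, and the slopes are nonnegative. The initial speed is 0,
    whence [m <= 0]. *)
Lemma dnode_ge w : m <= dnode w.
Proof.
elim: w => [|i w IH] //=.
have nab : al <= node b u v w <= be by exact: node_in.
have := m_delta i nab.
have /(ler_wpM2l) /(_ _ _ IH) : 0 <= Gdigit_dy i (node b u v w).
  by apply: Gdigit_dy_ge0; case/andP: nab.
lra.
Qed.

Lemma Hdigit_der_bounds : exists2 e, 0 < e & exists C,
  forall w, e <= Hdigit_der (node b u v w) (dnode w) <= C.
Proof.
have [/andP[b0 b1] u1 u2 v1 v2] := admissible_mul adm.
have [a1 a0 be0 _ _] := alpha_beta_bounds adm.
rewrite -/al -/be in a1 a0 be0.
have [M hM] := dnode_bound.
have bm : b * (1 - b) * m <= 0 by rewrite mulr_ge0_le0 // mulr_ge0; lra.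
(* As [m <= 0], nondegeneracy forces [db > 0], so [db * (1 + y)] is smallest at [y = al]. *)
have db0 : 0 < db.
  have : 0 < db * (al + 1).
    by move: nondegenerate bm; move: (b * (1 - b) * m) (db * (al + 1)) => p1 p2 *; lra.
  have a1' : 0 < al + 1 by lra.
  by rewrite pmulr_lgt0.
pose k := db * (al + 1) + b * (1 - b) * m.
have M0 : 0 <= M by apply: le_trans (hM [::]).
exists (k / (b * be + 1) ^+ 2).
  have bbe : 0 <= b * be by rewrite mulr_ge0 // ltW.
  by rewrite divr_gt0 // exprn_gt0 //; lra.
exists ((db * (1 + be) + b * (1 - b) * M) / (b * al + 1) ^+ 2) => w.
have /andP[ay yb] : al <= node b u v w <= be by exact: node_in.
have d0 := den_gt0 adm (lexx al); have d1 := den_gt0 adm ay.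
have dn1 := dnode_ge w; have dn2 : dnode w <= M by apply: le_trans (ler_norm _) (hM w).
have bb : 0 <= b * (1 - b) by rewrite mulr_ge0 //; lra.
have n1 := ler_wpM2l bb dn1; have n2 := ler_wpM2l bb dn2.
have y1 := ler_wpM2l (ltW db0) ay; have y2 := ler_wpM2l (ltW db0) yb.
have y3 := ler_wpM2l (ltW b0) ay; have y4 := ler_wpM2l (ltW b0) yb.
have sq (p q : R) : 0 < p -> p <= q -> (q ^+ 2)^-1 <= (p ^+ 2)^-1.
  move=> p0 pq; have q0 : 0 < q by exact: lt_le_trans pq.
  rewrite lef_pV2 ?posrE ?exprn_gt0 //.
  by apply: lerXn2r => //; rewrite nnegrE ltW.
rewrite /Hdigit_der; apply/andP; split; apply: ler_pM.
- exact: ltW.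
- by rewrite invr_ge0 sqr_ge0.
- by move: n1 y1; rewrite /k; lra.
- by apply: sq => //; lra.
- by move: n1 y1 nondegenerate; lra.
- by rewrite invr_ge0 sqr_ge0.
- lra.
- by apply: sq => //; lra.
Qed.

Lemma logder_oscillating : oscillating logder.
Proof.
have [e e0 [C hC]] := Hdigit_der_bounds.
apply: (oscillating_neq_step e0) => w.
have -> : logder (false :: w) - logder w =
    Hdigit_der (node b u v w) (dnode w) / Hdigit b false (node b u v w).
  by rewrite /= addrAC subrr add0r expr0 mul1r.
have /andP[l1 _] := hC w; apply: le_trans (ler_norm _); apply: le_trans l1 _.
have /andP[ay _] := node_in adm w.
have H0 := Hdigit_gt0 adm false ay; have H1 := Hdigit_gt0 adm true ay.
have := Hdigit_sum adm ay => s; have /andP[l1 _] := hC w.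
rewrite ler_pdivlMr // ger_pMr; lra.
Qed.

Lemma logder_subexponential : subexponential logder.
Proof.
have [e e0 [C hC]] := Hdigit_der_bounds.
have C0 : 0 <= C by have /andP[] := hC [::]; lra.
have [eta mt] := mass_mass_tree adm.
have [_ /andP[eta0 _] _ heta] := mt.
apply: (@subexponential_increments _ _ (fun=> 1) (C / eta)).
- by rewrite divr_ge0 // ltW.
- move=> i w; rewrite normr1 mulr1 /= addrAC subrr add0r.
  have hH : eta <= Hdigit b i (node b u v w).
    by rewrite -(ler_pM2l (mass_gt0 mt w)) [leLHS]mulrC; exact: heta.
  have H0 : 0 < Hdigit b i (node b u v w) by exact: lt_le_trans hH.
  have /andP[l1 l2] := hC w.
  rewrite normrM normrM normrX normrN1 expr1n mul1r (gtr0_norm (lt_le_trans e0 l1)).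
  rewrite normfV (gtr0_norm H0) ler_pM ?invr_ge0 ?(ltW H0) //; first lra.
  by rewrite lef_pV2 ?posrE.
- move=> lam l1; exists 1 => // w; rewrite normr1 mul1r exprn_ege1 //; lra.
Qed.

End Variation.

Section NegatedVariation.
Variables (R : realType) (b u v db du dv : R).

Lemma Gdigit_dtN i y :
  Gdigit_dt b u v (- db) (- du) (- dv) i y = - Gdigit_dt b u v db du dv i y.
Proof. by case: i => /=; ring. Qed.

Lemma dnodeN w :
  dnode b u v (- db) (- du) (- dv) w = - dnode b u v db du dv w.
Proof. by elim: w => [|i w /= ->]; rewrite ?oppr0 // Gdigit_dtN; ring. Qed.

Lemma logderN w :
  logder b u v (- db) (- du) (- dv) w = - logder b u v db du dv w.
Proof.
elim: w => [|i w /= ->]; first by rewrite oppr0.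
rewrite /Hdigit_der dnodeN; ring.
Qed.

End NegatedVariation.

Section AlongCurve.
Variables (R : realType) (b1 c0 c1 : R -> R) (db du dv : R).
Hypotheses (hb : is_derive (0 : R) (1 : R) b1 db)
  (hu : is_derive (0 : R) (1 : R) c0 du) (hv : is_derive (0 : R) (1 : R) c1 dv).
Local Notation b := (b1 0).
Local Notation u := (c0 0).
Local Notation v := (c1 0).
Hypothesis adm : admissible b u v.
Local Notation al := (alpha b u v).
Local Notation be := (beta b u v).
Implicit Types w : seq bool.

Lemma is_derive_const (x k : R) : is_derive x (1 : R) (fun=> k) (0 : R).
Proof. exact: is_derive_cst. Qed.

Lemma is_derive_Gdigit i (y : R -> R) dy : al <= y 0 ->
  is_derive (0 : R) (1 : R) y dy ->
  is_derive (0 : R) (1 : R) (fun t => Gdigit (b1 t) (c0 t) (c1 t) i (y t))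
    (Gdigit_dt b u v db du dv i (y 0) + Gdigit_dy b u v i (y 0) * dy).
Proof.
move=> ay hy; have d := den_gt0 adm ay.
have k1 := is_derive_const 0 1.
have dN : b * y 0 + 1 != 0 by rewrite gt_eqF.
case: i.
  have num := is_derive_add (is_derive_mul (is_derive_add
    (is_derive_add k1 (is_derive_opp hb)) hv) hy) hv.
  have den := is_derive_add (is_derive_mul hb hy) k1.
  by apply: is_derive_eq (is_derive_div num den dN) _; rewrite /=; field.
have h := is_derive_add (is_derive_mul (is_derive_mul hb (is_derive_add k1 hu)) hy) hu.
by apply: is_derive_eq h _; rewrite /=; ring.
Qed.

Lemma is_derive_Hdigit i (y : R -> R) dy : al <= y 0 ->
  is_derive (0 : R) (1 : R) y dy ->
  is_derive (0 : R) (1 : R) (fun t => Hdigit (b1 t) i (y t))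
    ((-1) ^+ i * Hdigit_der b db (y 0) dy).
Proof.
move=> ay hy; have d := den_gt0 adm ay.
have k1 := is_derive_const 0 1.
have dN : b * y 0 + 1 != 0 by rewrite gt_eqF.
have den := is_derive_add (is_derive_mul hb hy) k1.
case: i.
  have num := is_derive_add k1 (is_derive_opp hb).
  apply: is_derive_eq (is_derive_div num den dN) _.
  by rewrite /Hdigit_der expr1; field.
have num := is_derive_mul hb (is_derive_add k1 hy).
apply: is_derive_eq (is_derive_div num den dN) _.
by rewrite /Hdigit_der expr0; field.
Qed.

Lemma is_derive_node w :
  is_derive (0 : R) (1 : R) (fun t => node (b1 t) (c0 t) (c1 t) w)
    (dnode b u v db du dv w).
Proof.
elim: w => [|i w IH]; first exact: is_derive_const.
by apply: is_derive_Gdigit => //; case/andP: (node_in adm w).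
Qed.

Lemma is_derive_mass w :
  is_derive (0 : R) (1 : R) (fun t => mass (b1 t) (c0 t) (c1 t) w)
    (mass b u v w * logder b u v db du dv w).
Proof.
elim: w => [|i w IH]; first by rewrite mulr0; exact: is_derive_const.
have /andP[ay _] := node_in adm w.
have hH := is_derive_Hdigit i ay (is_derive_node w).
apply: is_derive_eq (is_derive_mul IH hH) _.
have H0 := Hdigit_gt0 adm i ay.
rewrite -[mass b u v (i :: w)]/(mass b u v w * Hdigit b i (node b u v w)).
rewrite -[logder _ _ _ _ _ _ (i :: w)]/(logder b u v db du dv w + (-1) ^+ i *
  Hdigit_der b db (node b u v w) (dnode b u v db du dv w) / Hdigit b i (node b u v w)).
move: H0; move: (Hdigit b i _) (Hdigit_der _ _ _ _) ((-1) ^+ i) => H1 D s H0.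
by field; rewrite gt_eqF.
Qed.

(** The value [d] is common to both endpoints of the dyadic interval and cancels in the increment,
    so its existence is all that is recorded. *)
Lemma is_derive_cumul w : exists d,
  is_derive (0 : R) (1 : R) (fun t => cumul (b1 t) (c0 t) (c1 t) w) d.
Proof.
elim: w => [|i w [d hd]]; first by exists 0; exact: is_derive_const.
case: i; last by exists (d + 0); apply: is_derive_add => //; exact: is_derive_const.
by eexists; apply: (is_derive_add hd); exact: (is_derive_mass (false :: w)).
Qed.

Lemma is_derive_Gdigit_dy i y : al <= y ->
  is_derive y (1 : R) (Gdigit b u v i) (Gdigit_dy b u v i y).
Proof.
move=> ay; have d := den_gt0 adm ay.
have dN : b * y + 1 != 0 by rewrite gt_eqF.
have aff (p q : R) : is_derive y (1 : R) (fun z => p * z + q) (0 * y + p * 1 + 0).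
  apply: is_derive_add (is_derive_const y q).
  by apply: is_derive_mul (is_derive_const y p) _; exact: is_derive_id.
case: i; last by apply: is_derive_eq (aff _ _) _; rewrite /=; ring.
by apply: is_derive_eq (is_derive_div (aff _ _) (aff _ _) dN) _; rewrite /=; field.
Qed.

Lemma G0_ratio y : al <= y -> delta_ratio (G0 b1 c0) y =
  Gdigit_dt b u v db du dv false y / (1 - Gdigit_dy b u v false y).
Proof.
move=> ay; rewrite /delta_ratio; congr (_ / (1 - _)).
  have h := is_derive_Gdigit false (y := fun=> y) ay (is_derive_const 0 y).
  by rewrite /dG_dt0 (derive1_is_derive h) mulr0 addr0.
exact: derive1_is_derive (is_derive_Gdigit_dy false ay).
Qed.

Lemma G1_dy y : al <= y -> dG_dy0 (G1 b1 c1) y = Gdigit_dy b u v true y.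
Proof. by move=> ay; exact: derive1_is_derive (is_derive_Gdigit_dy true ay). Qed.

Lemma G1_ratio y : al <= y -> delta_ratio (G1 b1 c1) y =
  Gdigit_dt b u v db du dv true y / (1 - Gdigit_dy b u v true y).
Proof.
move=> ay; rewrite /delta_ratio G1_dy //; congr (_ / _).
have h := is_derive_Gdigit true (y := fun=> y) ay (is_derive_const 0 y).
by rewrite /dG_dt0 (derive1_is_derive h) mulr0 addr0.
Qed.

Definition positive_drift (eb eu ev : R) :=
  (forall y, al <= y <= be -> Gdigit_dy b u v true y < 1) /\
  exists m, [/\ m <= 0,
    forall i y, al <= y <= be ->
      m * (1 - Gdigit_dy b u v i y) <= Gdigit_dt b u v eb eu ev i y &
    0 < eb * (al + 1) + b * (1 - b) * m].

Lemma ND_primal_drift : ND_primal b1 c0 c1 -> positive_drift db du dv.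
Proof.
have [/andP[b0 b1'] u1 u2 v1 v2] := admissible_mul adm.
move=> [ctr [d0 [d1 [[_ min0] [_ min1] pos]]]].
have ctr' y : al <= y <= be -> Gdigit_dy b u v true y < 1.
  by move=> yab; rewrite -G1_dy ?ctr //; case/andP: yab.
split => //; exists (Num.min 0 (Num.min d0 d1)); split.
- by rewrite ge_min lexx.
- move=> i y yab; have /andP[ay _] := yab.
  have p : 0 < 1 - Gdigit_dy b u v i y.
    by case: i; rewrite subr_gt0; [exact: ctr'|exact: u2].
  rewrite -ler_pdivlMr //.
  have yI : `[al, be]%classic y by rewrite /= in_itv.
  have := min0 _ (imageP _ yI); have := min1 _ (imageP _ yI).
  rewrite G0_ratio // G1_ratio // => h1 h0.
  case: i {p} => //.
    by apply: le_trans h1; rewrite !ge_min lexx !orbT.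
  by apply: le_trans h0; rewrite !ge_min lexx orbT.
- by move: pos; rewrite (derive1_is_derive hb).
Qed.

(** Running the curve backwards turns the maxima into minima and reverses the final inequality. *)
Lemma ND_dual_drift : ND_dual b1 c0 c1 -> positive_drift (- db) (- du) (- dv).
Proof.
have [/andP[b0 b1'] u1 u2 v1 v2] := admissible_mul adm.
move=> [ctr [d0 [d1 [[_ max0] [_ max1] neg]]]].
have ctr' y : al <= y <= be -> Gdigit_dy b u v true y < 1.
  by move=> yab; rewrite -G1_dy ?ctr //; case/andP: yab.
split => //; exists (- Num.max 0 (Num.max d0 d1)); split.
- by rewrite oppr_le0 le_max lexx.
- move=> i y yab; have /andP[ay _] := yab.
  have p : 0 < 1 - Gdigit_dy b u v i y.
    by case: i; rewrite subr_gt0; [exact: ctr'|exact: u2].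
  rewrite Gdigit_dtN mulNr lerN2 -ler_pdivrMr //.
  have yI : `[al, be]%classic y by rewrite /= in_itv.
  have := max0 _ (imageP _ yI); have := max1 _ (imageP _ yI).
  rewrite G0_ratio // G1_ratio // => h1 h0.
  case: i {p} => //.
    by apply: le_trans h1 _; rewrite !le_max lexx !orbT.
  by apply: le_trans h0 _; rewrite !le_max lexx orbT.
- move: neg; rewrite (derive1_is_derive hb) mulrN mulNr; lra.
Qed.

Lemma ND_logder : ND_primal b1 c0 c1 \/ ND_dual b1 c0 c1 ->
  oscillating (logder b u v db du dv) /\ subexponential (logder b u v db du dv).
Proof.
case=> [/ND_primal_drift|/ND_dual_drift] [ctr [m [m0 mG mpos]]].
  split; first exact (logder_oscillating adm ctr m0 mG mpos).
  exact (logder_subexponential adm ctr m0 mG mpos).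
have E : logder b u v db du dv = fun w => - logder b u v (- db) (- du) (- dv) w.
  by apply/funext => w; rewrite logderN opprK.
rewrite E; split; [apply: oscillatingN|apply: subexponentialN].
  exact (logder_oscillating adm ctr m0 mG mpos).
exact (logder_subexponential adm ctr m0 mG mpos).
Qed.

End AlongCurve.

(** * Reversal of the unit interval *)

Section Duality.
Variables (R : realType) (b u v : R).
Hypothesis adm : admissible b u v.
Local Notation b' := (1 - b).
Local Notation u' := (- (v / (1 + v))).
Local Notation v' := (- (u / (1 + u))).

(** In terms of 1 + u and 1 + v, duality is a swap followed by inversion, and it preserves the
    ranges b < 1 + u < 1/b and 1 - b < 1 + v < 1/(1 - b) once b is replaced by 1 - b. *)
Lemma dual_admissible : admissible b' u' v'.
Proof.
have [/andP[b0 b1] u1 u2 v1 v2] := admissible_mul adm.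
have u0 : 0 < 1 + u by lra.
have v0 : 0 < 1 + v by lra.
have -> : - (v / (1 + v)) = (1 + v)^-1 - 1 by field; rewrite gt_eqF.
have -> : - (u / (1 + u)) = (1 + u)^-1 - 1 by field; rewrite gt_eqF.
split; first lra.
- have h1 : b' < (1 + v)^-1 by rewrite -[ltRHS]mul1r ltr_pdivlMr // mulrC.
  have h2 : (1 + v)^-1 < b'^-1 by rewrite ltf_pV2 ?posrE //; lra.
  lra.
- have h1 : b < (1 + u)^-1 by rewrite -[ltRHS]mul1r ltr_pdivlMr.
  have h2 : (1 + u)^-1 < b^-1 by rewrite ltf_pV2 ?posrE //; lra.
  have -> : b' / (1 - b') = b^-1 - 1 by field; rewrite !gt_eqF //; lra.
  lra.
Qed.

(* Reversing [0, 1] replaces the distribution function [F] by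
   [1 - F (1 - .)] and flips all binary digits. *)
Lemma dual_node_mass w :
  node b' u' v' (map negb w) = - (node b u v w / (1 + node b u v w)) /\
  mass b' u' v' (map negb w) = mass b u v w.
Proof.
have [/andP[b0 b1] u1 u2 v1 v2] := admissible_mul adm.
have [a1 _ _ _ _] := alpha_beta_bounds adm.
have pos z : 0 < 1 + node b u v z by have /andP[] := node_in adm z; lra.
elim: w => [|i w [IHn IHm]]; first by rewrite /= mul0r oppr0.
have p1 := pos w; have p2 := node_den_gt0 adm w; have p3 := pos (i :: w).
rewrite /= IHn IHm {IHn IHm}; move: p1 p2 p3 => /=.
move: (node b u v w) (mass b u v w) => y M.
have u0 : 0 < 1 + u by lra.
have v0 : 0 < 1 + v by lra.
case: i => /= p1 p2 p3; split.
- have p4 : 0 < b * y + 1 + ((1 - b + v) * y + v).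
    have -> : b * y + 1 + ((1 - b + v) * y + v) =
        (1 + ((1 - b + v) * y + v) / (b * y + 1)) * (b * y + 1).
      by field; rewrite gt_eqF.
    exact: mulr_gt0.
  by field; rewrite !gt_eqF //=; lra.
- by congr (_ * _); field; rewrite !gt_eqF //=; lra.
- by field; rewrite !gt_eqF //=; lra.
- by congr (_ * _); field; rewrite !gt_eqF //=; lra.
Qed.

End Duality.

Lemma oscillating_flip (R : realType) (U : seq bool -> R) :
  oscillating U -> oscillating (fun w => U (map negb w)).
Proof.
case=> l [d [d0 h]]; exists l, d; split => // w.
have [v sv hv] := h (map negb w).
exists (map negb v); first by rewrite size_map.
by rewrite map_cat -map_comp (eq_map negbK) map_id.
Qed.

Lemma subexponential_flip (R : realType) (U : seq bool -> R) :
  subexponential U -> subexponential (fun w => U (map negb w)).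
Proof.
move=> h lam /h[C C0 hC]; exists C => // w.
by rewrite -(size_map negb w); exact: hC.
Qed.

Lemma condND_logarithmic_derivative (R : realType) (I : set R) (b1 c0 c1 : R -> R) :
  open I -> I 0 ->
  (forall t, I t -> admissible (b1 t) (c0 t) (c1 t)) ->
  derivable b1 0 1 -> derivable c0 0 1 -> derivable c1 0 1 ->
  condND b1 c0 c1 ->
  exists W : seq bool -> R, [/\ oscillating W, subexponential W &
    forall w, is_derive (0 : R) (1 : R) (fun t => mass (b1 t) (c0 t) (c1 t) w)
                (mass (b1 0) (c0 0) (c1 0) w * W w)].
Proof.
move=> oI I0 adm /derivableP hb /derivableP hu /derivableP hv.
case=> [nd|nd].
  have [oW sW] := ND_logder hb hu hv (adm 0 I0) (or_introl nd).
  by eexists; split; [exact: oW|exact: sW|move=> w; exact: (is_derive_mass hb hu hv (adm 0 I0) w)].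
have [/andP[b0 b1'] u1 u2 v1 v2] := admissible_mul (adm 0 I0).
have k1 := is_derive_const (0 : R) 1.
have uN : 1 + c0 0 != 0 by apply/eqP; lra.
have vN : 1 + c1 0 != 0 by apply/eqP; lra.
have hb' : is_derive (0 : R) (1 : R) (dual_b1 b1) _ :=
  is_derive_add k1 (is_derive_opp hb).
have hu' : is_derive (0 : R) (1 : R) (dual_c0 c1) _ :=
  is_derive_opp (is_derive_div hv (is_derive_add k1 hv) vN).
have hv' : is_derive (0 : R) (1 : R) (dual_c1 c0) _ :=
  is_derive_opp (is_derive_div hu (is_derive_add k1 hu) uN).
have adm' := dual_admissible (adm 0 I0).
have [oW sW] := ND_logder hb' hu' hv' adm' (or_intror nd).
eexists; split; [exact: oscillating_flip oW|exact: subexponential_flip sW|].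
move=> w; have [_ e] := dual_node_mass (adm 0 I0) w.
(* The mass of [w] agrees with the dual mass of the flipped word for all [t] near 0, so the
   derivatives agree as well. *)
rewrite -{1}e; apply: near_eq_is_derive (is_derive_mass hb' hu' hv' adm' _).
have : nbhs (0 : R) I by exact: open_nbhs_nbhs.
apply: filterS => t It; have [_ e'] := dual_node_mass (adm t It) w.
exact: e'.
Qed.

(** * Linear curves *)

Lemma derive1n_eq_on (R : realType) (I : set R) (f g : R -> R) n :
  open I -> (forall t, I t -> f t = g t) ->
  forall t, I t -> derive1n n f t = derive1n n g t.
Proof.
move=> oI fg; elim: n => [|n IH] t It; first exact: fg.
rewrite !derive1nS !derive1E; apply: near_eq_derive.
have : nbhs t I by exact: open_nbhs_nbhs.
by apply: filterS => s Is; exact: IH.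
Qed.

Lemma derive1n_horner (R : realType) (p : {poly R}) n :
  derive1n n (horner p) = horner (p^`(n)).
Proof. by elim: n => // n IH; rewrite derive1nS IH -derivE derivnS. Qed.

Section LinearCurve.
Variables (R : realType) (a : R).
Hypothesis a01 : 0 < a < 1.
Implicit Types w : seq bool.

Fixpoint mass_poly w : {poly R} :=
  if w is i :: w' then
    mass_poly w' * (if i then (1 - a)%:P - 'X else 'X + a%:P)
  else 1.

Fixpoint cumul_poly w : {poly R} :=
  if w is i :: w' then
    cumul_poly w' + (if i then mass_poly (false :: w') else 0)
  else 0.

Lemma node_linear (b : R) w : node b 0 0 w = 0.
Proof. by elim: w => //= i w ->; case: i; rewrite /= !mulr0 !addr0 ?mul0r. Qed.

Lemma Hdigit0 (b : R) i : Hdigit b i 0 = if i then 1 - b else b.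
Proof. by case: i; rewrite /Hdigit mulr0 add0r divr1 // addr0 mulr1. Qed.

Lemma mass_linearS (b : R) i w :
  mass b 0 0 (i :: w) = mass b 0 0 w * (if i then 1 - b else b).
Proof. by rewrite [LHS]/= node_linear Hdigit0. Qed.

Lemma horner_mass_poly t w : (mass_poly w).[t] = mass (t + a) 0 0 w.
Proof.
elim: w => [|i w IH]; first by rewrite hornerC.
rewrite [mass_poly _]/= hornerM IH mass_linearS.
by case: i; rewrite !hornerE; ring.
Qed.

Lemma horner_cumul_poly t w : (cumul_poly w).[t] = cumul (t + a) 0 0 w.
Proof.
elim: w => [|i w IH] /=; first by rewrite hornerC.
rewrite hornerD IH; congr (_ + _); case: i; last by rewrite hornerC.
exact: horner_mass_poly (false :: w).
Qed.

(** Multiplied by k!, this is the k-th derivative at 0 of the mass of [w] relative to the mass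
    itself. *)
Definition mass_coef k w : R := (mass_poly w)`_k / mass a 0 0 w.

Lemma mass_linear_gt0 w : 0 < mass a 0 0 w.
Proof.
elim: w => [|i w IH]; first exact: ltr01.
rewrite mass_linearS mulr_gt0 //; have /andP[a0 a1] := a01; case: i; lra.
Qed.

Lemma mass_coef0 w : mass_coef 0 w = 1.
Proof.
rewrite /mass_coef -horner_coef0 horner_mass_poly add0r divff //.
by rewrite gt_eqF // mass_linear_gt0.
Qed.

Lemma mass_coefS k i w : mass_coef k.+1 (i :: w) - mass_coef k.+1 w =
  mass_coef k w * (if i then - (1 - a)^-1 else a^-1).
Proof.
have m0 := mass_linear_gt0 w; have /andP[a0 a1] := a01.
rewrite /mass_coef mass_linearS; case: i => /=.
  by rewrite mulrBr coefB coefMC coefMX /=; field; rewrite !gt_eqF //; lra.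
by rewrite mulrDr coefD coefMC coefMX /=; field; rewrite !gt_eqF //; lra.
Qed.

(* Appending a 0 or a 1 moves the coefficient in opposite directions, so one of
   the two results stays at distance 1 from any prescribed value. *)
Lemma mass_coef_step k u r : 1 <= `|mass_coef k u| ->
  exists i, 1 <= `|mass_coef k.+1 (i :: u) - r|.
Proof.
move=> large; have /andP[a0 a1] := a01.
have ia : 1 <= a^-1 by rewrite invf_ge1 // ltW.
have ib : 1 <= (1 - a)^-1 by rewrite invf_ge1; lra.
apply: contrapT => nex.
have small i : `|mass_coef k.+1 (i :: u) - r| < 1.
  by rewrite ltNge; apply/negP => h; apply: nex; exists i.
have := small false; have := small true.
rewrite !ltr_norml => /andP[s1 s2] /andP[s3 s4].
have e0 := mass_coefS k false u; have e1 := mass_coefS k true u.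
have : 2 <= `|mass_coef k u * (a^-1 + (1 - a)^-1)|.
  rewrite normrM [X in _ * X]ger0_norm; last lra.
  by rewrite -[leLHS]mul1r; apply: ler_pM; lra.
have -> : mass_coef k u * (a^-1 + (1 - a)^-1) =
    mass_coef k.+1 (false :: u) - mass_coef k.+1 (true :: u).
  by rewrite mulrDr; lra.
by rewrite leNgt ltr_norml; move/negP; apply; apply/andP; split; lra.
Qed.

Lemma mass_coef_large k w : exists2 v, size v = k & 1 <= `|mass_coef k (v ++ w)|.
Proof.
elim: k => [|k [v sv large]].
  by exists [::] => //; rewrite mass_coef0 normr1.
have [i hi] := mass_coef_step 0 large.
by exists (i :: v); rewrite /= ?sv // -[X in `|X|]subr0.
Qed.

(** After some [k] digits the coefficient of order [k] is at least 1 in absolute value; one further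
    digit can then push the coefficient of order [k.+1] away from its value at the starting word. *)
Lemma mass_coef_oscillating k : oscillating (mass_coef k.+1).
Proof.
exists k.+1, 1; split => // w.
have [v sv large] := mass_coef_large k w.
have [i hi] := mass_coef_step (mass_coef k.+1 w) large.
by exists (i :: v) => //=; rewrite sv.
Qed.

Lemma mass_coef_subexponential k : subexponential (mass_coef k).
Proof.
have /andP[a0 a1] := a01.
have ia : 0 < a^-1 by rewrite invr_gt0.
have ib : 0 < (1 - a)^-1 by rewrite invr_gt0; lra.
elim: k => [|k IH].
  move=> lam l1; exists 1 => // w.
  by rewrite mass_coef0 normr1 mul1r exprn_ege1 // ltW.
apply: (@subexponential_increments _ _ (mass_coef k) (a^-1 + (1 - a)^-1)) IH.
  by lra.
move=> i w; rewrite mass_coefS normrM mulrC ler_wpM2r //.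
by case: i; rewrite ?normrN gtr0_norm //; lra.
Qed.

End LinearCurve.

Lemma oscillatingZ (R : realType) (U : seq bool -> R) (s : R) : 0 < s ->
  oscillating U -> oscillating (fun w => s * U w).
Proof.
move=> s0 [l [d [d0 h]]]; exists l, (s * d); split; first exact: mulr_gt0.
move=> w; have [v sv hv] := h w; exists v => //.
by rewrite -mulrBr normrM gtr0_norm // ler_pM2l.
Qed.

Lemma subexponentialZ (R : realType) (U : seq bool -> R) (s : R) : 0 < s ->
  subexponential U -> subexponential (fun w => s * U w).
Proof.
move=> s0 h lam /h[C C0 hC]; exists (s * C); first by rewrite mulr_ge0 // ltW.
by move=> w; rewrite normrM gtr0_norm // -mulrA ler_pM2l.
Qed.

(** * Increments of f_k over dyadic intervals *)

Section CurveInE.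
Variables (R : realType) (I : set R) (b1 c0 c1 : R -> R) (F : R -> R -> R).
Hypotheses (oI : open I) (I0 : I 0).
Hypothesis adm : forall t, I t -> admissible (b1 t) (c0 t) (c1 t).
Hypothesis hF : forall t, I t -> deRham_solution (A0 b1 c0 t) (A1 b1 c1 t) (F t).
Implicit Types w : seq bool.

Lemma F_lft t w : I t -> F t (lft w) = cumul (b1 t) (c0 t) (c1 t) w.
Proof. by move=> It; exact (deRham_lft (adm It) (hF It) w). Qed.

Lemma F_rgt t w : I t -> F t (rgt w) =
  cumul (b1 t) (c0 t) (c1 t) w + mass (b1 t) (c0 t) (c1 t) w.
Proof. by move=> It; exact (deRham_rgt (adm It) (hF It) w). Qed.

Lemma fder_increment_linear k : (1 <= k)%N -> condL I b1 c0 c1 ->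
  exists W : seq bool -> R, [/\ oscillating W, subexponential W &
    forall w, fder F k (rgt w) - fder F k (lft w) =
              mass (b1 0) (c0 0) (c1 0) w * W w].
Proof.
case: k => // k _ [a [a01 hL]].
have fact0 : 0 < (k.+1)`!%:R :> R by rewrite ltr0n fact_gt0.
exists (fun w => (k.+1)`!%:R * mass_coef a k.+1 w); split.
- exact: oscillatingZ fact0 (mass_coef_oscillating a01 k).
- exact: subexponentialZ fact0 (mass_coef_subexponential a01 k.+1).
move=> w.
(* On all of [I] the value of F at a dyadic endpoint is a polynomial in [t], so its iterated
   derivatives at 0 can be read off the coefficients. *)
have coefE (p : {poly R}) : derive1n k.+1 (horner p) 0 = p`_k.+1 *+ (k.+1)`!.
  by rewrite derive1n_horner horner_coef0 coef_derivn addn0 ffactnn.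
have el : fder F k.+1 (lft w) = derive1n k.+1 (horner (cumul_poly a w)) 0.
  apply: derive1n_eq_on oI _ _ I0 => t It.
  by rewrite F_lft // horner_cumul_poly; have [-> -> ->] := hL t It.
have er : fder F k.+1 (rgt w) = derive1n k.+1 (horner (cumul_poly a w + mass_poly a w)) 0.
  apply: derive1n_eq_on oI _ _ I0 => t It.
  rewrite F_rgt // hornerD horner_cumul_poly horner_mass_poly.
  by have [-> -> ->] := hL t It.
have [-> -> ->] := hL 0 I0.
rewrite el er !coefE coefD mulrnDl addrAC subrr add0r add0r.
rewrite /mass_coef mulrCA -[LHS]mulr_natl; congr (_ * _).
by rewrite mulrCA divff ?mulr1 // gt_eqF // mass_linear_gt0.
Qed.

Lemma fder_increment_first :
  derivable b1 0 1 -> derivable c0 0 1 -> derivable c1 0 1 ->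
  condND b1 c0 c1 ->
  exists W : seq bool -> R, [/\ oscillating W, subexponential W &
    forall w, fder F 1 (rgt w) - fder F 1 (lft w) =
              mass (b1 0) (c0 0) (c1 0) w * W w].
Proof.
move=> db dc0 dc1 nd.
have [W [oW sW hW]] := condND_logarithmic_derivative oI I0 adm db dc0 dc1 nd.
exists W; split => // w.
have [d hd] := is_derive_cumul (derivableP db) (derivableP dc0) (derivableP dc1) (adm I0) w.
have nI : nbhs (0 : R) I by exact: open_nbhs_nbhs.
have el : is_derive (0 : R) (1 : R) (fun t => F t (lft w)) d.
  by apply: near_eq_is_derive hd; apply: filterS nI => t It; rewrite F_lft.
have er : is_derive (0 : R) (1 : R) (fun t => F t (rgt w))
    (d + mass (b1 0) (c0 0) (c1 0) w * W w).
  apply: near_eq_is_derive (is_derive_add hd (hW w)).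
  by apply: filterS nI => t It; rewrite F_rgt.
rewrite /fder !derive1n1 (derive1_is_derive el) (derive1_is_derive er).
by rewrite addrAC subrr add0r.
Qed.

End CurveInE.

(** The exponent is c = 1 - ln tau / ln 2, the solution of 2^-c = tau / 2. *)
Lemma order_exponent (R : realType) (tau : R) : 1 <= tau < 2 ->
  exists c : R, [/\ 0 <= c <= 1, 1 < tau -> c < 1, tau = 1 -> c = 1 &
    forall n, (2^-1 ^+ n) `^ c = (tau / 2) ^+ n].
Proof.
move=> /andP[t1 t2].
have l2 : 0 < ln (2 : R) by rewrite ln_gt0 // ltr1n.
have lt0 : 0 <= ln tau by rewrite ln_ge0.
have lt2 : ln tau <= ln 2 by rewrite ler_ln ?posrE //; lra.
exists (1 - ln tau / ln 2); split.
- by rewrite subr_ge0 ler_pdivrMr // mul1r lt2 /= gerBl; apply: divr_ge0 => //; exact: ltW.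
- by move=> t1'; rewrite gtrBl; apply: divr_gt0 => //; exact: ln_gt0.
- by move=> e; rewrite e ln1 mul0r subr0.
move=> n; have t20 : 0 <= tau / 2 by lra.
rewrite -[2^-1 ^+ n]powR_mulrn ?invr_ge0 // powRAC -[RHS]powR_mulrn //.
congr (_ `^ _); rewrite /powR gt_eqF ?invr_gt0 // lnV ?posrE //.
have -> : (1 - ln tau / ln 2) * - ln 2 = ln tau - ln 2 by field; rewrite gt_eqF.
by rewrite expRD expRN !lnK ?posrE //; lra.
Qed.

Theorem theorem6p3 (R : realType) (I : set R) (b1 c0 c1 : R -> R)
    (F : R -> R -> R) (mu0 : probability (measurableTypeR R) R)
    (hI : open_interval I) (hI0 : I 0)
    (hcurve : smooth_curve_in_E I b1 c0 c1)
    (hF : forall t, I t -> deRham_solution (A0 b1 c0 t) (A1 b1 c1 t) (F t))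
    (hmu0 : distribution_function01 mu0 (F 0))
    (hND : condND b1 c0 c1) :
  exists c : R,
    [/\ 0 <= c <= 1,
        mutually_singular mu0 (@lebesgue_measure R) -> c < 1,
        mu0 `<< @lebesgue_measure R -> c = 1 &
        forall k : nat, (1 <= k)%N -> k = 1%N \/ condL I b1 c0 c1 ->
          {ae mu0, forall x : R, 0 <= x <= 1 ->
             limsup_quotient (fder F k) c x = +oo%E} /\
          (forall J : set R, open_interval J -> J !=set0 -> J `<=` `[0, 1] ->
             ereal_sup (difference_quotients (fder F k) c J) = +oo%E /\
             ereal_inf (difference_quotients (fder F k) c J) = -oo%E)].
Proof.
have [oI _] := hI.
have [sb sc0 sc1 hE] := hcurve.
have adm t : I t -> admissible (b1 t) (c0 t) (c1 t).
  by move=> /hE [? ? ? _]; split.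
have [eta mt] := mass_mass_tree (adm 0 hI0).
set m := mass (b1 0) (c0 0) (c1 0) in mt.
have mu0_itv w : mu0 `]lft w, rgt w]%classic = (m w)%:E.
  have [_ hmu] := hmu0.
  have lr := lft_lt_rgt R w; have l0 := lft_ge0 R w; have r1 := rgt_le1 R w.
  have hl : mu0 `[0, lft w]%classic = (F 0 (lft w))%:E by apply: hmu; lra.
  have hr : mu0 `[0, rgt w]%classic = (F 0 (rgt w))%:E by apply: hmu; lra.
  have -> : `]lft w, rgt w]%classic =
      `[0, rgt w]%classic `\` `[0, lft w]%classic :> set R.
    apply/seteqP; split => x /=; rewrite !in_itv /=.
      by move=> /andP[x1 x2]; split; [lra|apply/negP; lra].
    by move=> [/andP[x1 x2] /negP]; rewrite negb_and -!ltNge; lra.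
  have sub : `[0, lft w]%classic `<=` (`[0, rgt w]%classic : set R).
    by move=> x /=; rewrite !in_itv /=; lra.
  rewrite measureD; [|exact: measurable_itv|exact: measurable_itv|]; last first.
    by rewrite (_ : _ `[0, rgt w]%classic = (F 0 (rgt w))%:E) ?ltry //; exact: hr.
  rewrite (setIidr sub) -[RHS]/(m w)%:E.
  rewrite (_ : m w = F 0 (rgt w) - F 0 (lft w)); last first.
    by rewrite (F_lft adm hF w hI0) (F_rgt adm hF w hI0) addrAC subrr add0r.
  by rewrite EFinB; congr (_ - _)%E; [exact: hr|exact: hl].
(* The cells are open on the left and miss 0, so this point is handled apart. *)
have mu0_0 : mu0 [set 0] = 0%E.
  have [_ hmu] := hmu0; have := hmu 0; rewrite lexx ler01 => /(_ isT).
  rewrite set_itv1 => ->.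
  by rewrite (deRham_0 (adm 0 hI0) (hF 0 hI0)).
(* Here [tau] is chosen before [k]. The two claims on [c] follow by contraposition: [tau = 1]
   excludes singularity and [1 < tau] excludes absolute continuity. *)
suff [tau t12 [reg sing dom]] : exists2 tau, 1 <= tau < 2 &
    [/\ mass_regime m tau,
        tau = 1 -> ~ mutually_singular mu0 (@lebesgue_measure R) &
        1 < tau -> ~ (mu0 `<< @lebesgue_measure R)].
  have [c [c01 cs ca scale]] := order_exponent t12.
  have [t1 _] := andP t12.
  have c_ge0 : 0 <= c by case/andP: c01.
  have tau_gt0 : 0 < tau by exact: lt_le_trans t1.
  exists c; split => //.
  - move=> ms; apply: cs; rewrite lt_neqAle t1 andbT eq_sym.
    by apply/eqP => e; exact: sing e ms.
  - move=> ac; apply: ca; apply/eqP; rewrite eq_le t1 andbT leNgt.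
    by apply/negP => h; exact: dom h ac.
  move=> k k1 kL.
  have [W [oW sW incr]] : exists W : seq bool -> R, [/\ oscillating W, subexponential W &
      forall w, fder F k (rgt w) - fder F k (lft w) = m w * W w].
    case: kL => [->|hL]; last by exact: (fder_increment_linear oI hI0 adm hF k1 hL).
    exact: (fder_increment_first oI hI0 adm hF (sb 0%N 0 hI0) (sc0 0%N 0 hI0)
      (sc1 0%N 0 hI0) hND).
  split.
    exact: (irregular_ae mt mu0_itv mu0_0 c_ge0 tau_gt0 scale reg incr oW).
  move=> J [oJ _] Jn0 J01.
  exact: (irregular_everywhere mt tau_gt0 scale reg incr oW sW oJ Jn0 J01).
have [[hu hv]|not_ac] :=
    pselect (c0 0 = 1 / (2 * b1 0) - 1 /\ c1 0 = 1 - 2 * b1 0).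
  have [kappa [K [k0 K0 bnd]]] := ac_mass_bounds (adm 0 hI0) hu hv.
  exists 1; first by rewrite lexx ltr1n.
  split; last by rewrite ltxx.
  - by left; split => //; exists kappa => // w; case/andP: (bnd w).
  - move=> _; apply: (bounded_density_not_singular mt mu0_itv K0) => w.
    by case/andP: (bnd w).
have [tau /andP[t1 t2] reg] := singular_regime (adm 0 hI0) not_ac.
exists tau; first by rewrite ltW.
split => //; first by move=> e; move: t1; rewrite e ltxx.
by move=> _; exact (regime_not_dominated mt mu0_itv t1 reg).
Qed.
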